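(* Assume conditions (A1)–(A5) of the context, and at least one of conditions (A6), (A7) of the context. Let $h>0$, let $G_h$ be the finite grid of the context, and let $\{(\xi_n^h,\alpha_n^h)\}$ be the controlled Markov chain on $G_h\times\mathcal{M}$ with the transition probabilities $p^h$ given in the context. Suppose $h$ satisfies, for all $(x,\iota)\in G_h\times\mathcal{M}$ and all $j_0\in\{1,\dots,l_0\}$, $$h\cdot\max_{(r_1,r_2)\in U_1\times U_2}|b_{j_0}(x,\iota,r_1,r_2)|\ \le\ \min_{j}\Big\{a_{jj}(x,\iota)-\sum_{k\ne j}|a_{jk}(x,\iota)|\Big\}.$$ Let $V^{h,+}$ and $V^{h,-}$ be the upper and lower values of the associated discrete game defined in the context. Then there exists a saddle point: $$V^{h,+}(x,\iota)=V^{h,-}(x,\iota)\quad\text{for all } x\in G_h,\ \iota\in\mathcal{M}.$$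
   Context: **Diffusion game.** $\mathcal{M}=\{1,\dots,m_0\}$; $U_1,U_2\subset\mathbb{R}$ are compact; $b:\mathbb{R}^{l_0}\times\mathcal{M}\times\mathbb{R}\times\mathbb{R}\to\mathbb{R}^{l_0}$ and $\sigma:\mathbb{R}^{l_0}\times\mathcal{M}\to\mathbb{R}^{l_0\times l_0}$. The dynamics are $$x(t)=x(0)+\int_0^t b(x(s),\alpha(s),u_1(s),u_2(s))\,ds+\int_0^t\sigma(x(s),\alpha(s))\,dw(s),\qquad(\ast)$$ where $w$ is a standard $\mathbb{R}^{l_0}$-valued Brownian motion, $\alpha$ is a continuous-time Markov chain on $\mathcal{M}$ with generator $Q=(q_{\iota\ell})$, and the $u_i$ are $U_i$-valued controls adapted to a filtration $\mathcal{F}_t$ (possibly depending on the controls) that measures at least $\{(w(s),\alpha(s)):s\le t\}$. Put $A(x,\iota)=\sigma(x,\iota)\sigma'(x,\iota)=(a_{jk}(x,\iota))$, assumed symmetric positive definite. $G\subset\mathbb{R}^{l_0}$ is a compact set which is the closure of its interior $G^o$. $\beta>0$ is a discount factor, and $\widetilde k(x,\iota,r_1,r_2)$, $\widetilde g(x,\iota)$ are real-valued running and terminal costs. A relaxed control for player $i$ is a measure $m_i$ on the Borel sets of $U_i\times[0,\infty)$ with $m_i(U_i\times[0,t])=t$ for all $t\ge0$, adapted in the same sense as ordinary controls; it factors as $m_i(dr\,dt)=m_{i,t}(dr)\,dt$. With relaxed controls, the drift in $(\ast)$ is replaced by $\int_{U_1}\int_{U_2}b(x(s),\alpha(s),r_1,r_2)\,m_{1,s}(dr_1)\,m_{2,s}(dr_2)$.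 **Assumptions.** (A1) For each $\iota$, $\widetilde k(\cdot,\iota,\cdot,\cdot)$ and $b(\cdot,\iota,\cdot,\cdot)$ are continuous on $G\times U_1\times U_2$. (A2) For each $\iota$, $\sigma(\cdot,\iota)$ and $\widetilde g(\cdot,\iota)$ are continuous on $G$. (A3) Equation $(\ast)$ with relaxed controls has a unique weak-sense solution (unique in distribution) for each admissible triple $(w,\alpha,m)$, $m=(m_1,m_2)$. (A4) For all $\iota$ (and $x\in G$) and all $j$, $a_{jj}(x,\iota)>\sum_{k\ne j}|a_{jk}(x,\iota)|$. (A5) Let $\hat\tau(\phi)=\infty$ if $\phi(t)\in G^o$ for all $t<\infty$, and $\hat\tau(\phi)=\inf\{t:\phi(t)\notin G^o\}$ otherwise. The function $\hat\tau$ is continuous as a map from $D[0,\infty)$ (right-continuous functions with left limits, Skorohod topology) to the compactified interval $[0,\infty]$, with probability one relative to the measure induced by any solution of $(\ast)$ with initial condition $(x,\iota)$. (A6) For every $(x,\iota)\in G\times\mathcal{M}$, $b$ and $\widetilde k$ are separable: $b(x,\iota,r_1,r_2)=\sum_{i=1}^2b^i(x,\iota,r_i)$ and $\widetilde k(x,\iota,r_1,r_2)=\sum_{i=1}^2\widetilde k^i(x,\iota,r_i)$. (A7) $\widetilde k$ is convex-concave in $(r_1,r_2)$ (convex in $r_1$, concave in $r_2$; this presupposes that $U_1,U_2$ are convex), and there are continuous $\mathbb{R}^{l_0}$-valued functions $b^i(x,\iota)$, $i=0,1,2,3$, with $b(x,\iota,r_1,r_2)=r_1r_2b^0(x,\iota)+r_1b^1(x,\iota)+r_2b^2(x,\iota)+b^3(x,\iota)$.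 **Approximating chain.** For each $h>0$, $G_h$ is a finite subset of $G$ (grid of mesh $h$), with $\max_{p\in G}\min_{q\in G_h}|p-q|\to0$ as $h\to0$. $G_h^o$ denotes the interior points of the grid: points $x\in G_h\cap G^o$ all of whose grid neighbours $x\pm e_jh$, $x\pm e_jh\pm e_kh$ ($j\neq k$) lie in $G_h$; here $e_j$ is the $j$-th standard unit vector. Write $a^+=\max(a,0)$, $a^-=\max(-a,0)$, $r=(r_1,r_2)$, and $$D^h(x,\iota)=\sum_{j}a_{jj}(x,\iota)-\sum_{j<k}|a_{jk}(x,\iota)|-q_{\iota\iota}h^2+\beta h^2,\qquad \Delta t^h(x,\iota)=\frac{h^2}{D^h(x,\iota)}.$$ For $x\in G_h^o$ the controlled transition probabilities are $$p^h((x,\iota),(x\pm e_jh,\iota)|r)=\frac{\pm h\,b_j(x,\iota,r)+a_{jj}(x,\iota)-\sum_{k\ne j}|a_{jk}(x,\iota)|}{2(D^h(x,\iota)-\beta h^2)},\quad j=1,\dots,l_0,$$ $$p^h((x,\iota),(x+e_jh+e_kh,\iota)|r)=p^h((x,\iota),(x-e_jh-e_kh,\iota)|r)=\frac{\tfrac12a_{jk}^+(x,\iota)}{D^h(x,\iota)-\beta h^2},\quad j<k,$$ $$p^h((x,\iota),(x+e_jh-e_kh,\iota)|r)=\frac{\tfrac12a_{jk}^-(x,\iota)}{D^h(x,\iota)-\beta h^2},\quad j\ne k,$$ $$p^h((x,\iota),(x,\ell)|r)=\frac{q_{\iota\ell}h^2}{D^h(x,\iota)-\beta h^2},\quad \ell\ne\iota,$$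 and $p^h((x,\iota),(y,\ell)|r)=0$ otherwise. The chain is stopped at $N_h=\inf\{n:\xi_n^h\notin G_h^o\}$. **Discrete game.** Let $u_{i,n}^h\in U_i$ be the action of player $i$ at step $n$, $\Delta t_n^h=\Delta t^h(\xi_n^h,\alpha_n^h)$ and $t_n^h=\sum_{j=0}^{n-1}\Delta t_j^h$. The cost from $(x,\iota)$ is $$W^h(x,\iota,u_1^h,u_2^h)=E_{x,\iota}\Big[\sum_{n=0}^{N_h-1}e^{-\beta t_n^h}\,\widetilde k(\xi_n^h,\alpha_n^h,u_{1,n}^h,u_{2,n}^h)\,\Delta t_n^h+\widetilde g(\xi_{N_h}^h,\alpha_{N_h}^h)\Big],$$ the terminal term being absent on $\{N_h=\infty\}$. $\mathcal{U}_i^h(1)$ (player $i$ goes first) is the set of controls for which $u_{i,n}^h$ is a measurable function of $\{\xi_k^h,\alpha_k^h,k\le n;\ u_{1,k}^h,u_{2,k}^h,k<n\}$. $\mathcal{U}_i^h(2)$ (player $i$ goes last) is the set of controls for which $u_{i,n}^h$ is a measurable function of $\{\xi_k^h,\alpha_k^h,k\le n;\ u_{i,k}^h,k<n;\ u_{j,k}^h,k\le n,\ j\ne i\}$. The values are $$V^{h,+}(x,\iota)=\inf_{u_1^h\in\mathcal{U}_1^h(1)}\ \sup_{u_2^h\in\mathcal{U}_2^h(2)}W^h(x,\iota,u_1^h,u_2^h),\qquad V^{h,-}(x,\iota)=\sup_{u_2^h\in\mathcal{U}_2^h(1)}\ \inf_{u_1^h\in\mathcal{U}_1^h(2)}W^h(x,\iota,u_1^h,u_2^h).$$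 *)

(* Defs.v *)
From HB Require Import structures.
From mathcomp Require Export all_boot all_order all_algebra.
From mathcomp Require Export all_classical all_reals all_analysis.
From mathcomp Require Export measurable_realfun.
Export Order.TTheory GRing.Theory Num.Theory.
Export numFieldNormedType.Exports.

Set Implicit Arguments.
Unset Strict Implicit.
Unset Printing Implicit Defensive.

Local Open Scope classical_set_scope.
Local Open Scope ring_scope.

(* Points of R^l are row vectors and the regimes are ['I_m].  [grid h] is the
   grid of mesh [h], [act1] and [act2] are the action sets, [dom] is the
   compact set in which the game is played. *)

Record game (R : realType) (l m : nat) := Game {
  drift : 'rV[R]_l -> 'I_m -> R -> R -> 'rV[R]_l;
  sigma : 'rV[R]_l -> 'I_m -> 'M[R]_l;
  kcost : 'rV[R]_l -> 'I_m -> R -> R -> R;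
  gcost : 'rV[R]_l -> 'I_m -> R;
  gen : 'M[R]_m;
  beta : R;
  act1 : set R;
  act2 : set R;
  dom : set 'rV[R]_l;
  grid : R -> set 'rV[R]_l
}.

Section Basic.
Context {R : realType} {l m : nat}.
Implicit Types (D : game R l m) (x y : 'rV[R]_l) (i : 'I_m) (h : R).

Definition diffusion D x i : 'M[R]_l := sigma D x i *m (sigma D x i)^T.

Definition pos_def (A : 'M[R]_l) : Prop :=
  A^T = A /\ forall v : 'rV[R]_l, v != 0 -> 0 < (v *m A *m v^T) 0 0.

Definition is_generator (Q : 'M[R]_m) : Prop :=
  (forall i j, i != j -> 0 <= Q i j) /\ (forall i, \sum_j Q i j = 0).

Definition dominance (A : 'M[R]_l) (j : 'I_l) : R :=
  A j j - \sum_(k | k != j) `|A j k|.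

Definition unitv (j : 'I_l) : 'rV[R]_l := delta_mx 0 j.

(* A grid of mesh [h] is a subset of some translate of the lattice [h Z^l]. *)
Definition in_lattice h (A : set 'rV[R]_l) : Prop :=
  exists o : 'rV[R]_l, forall x, A x ->
    exists z : 'rV[int]_l, x = o + h *: map_mx intr z.

Record standing D : Prop := Standing {
  act1_compact : compact (act1 D);
  act2_compact : compact (act2 D);
  act1_nonempty : act1 D !=set0;
  act2_nonempty : act2 D !=set0;
  gen_generator : is_generator (gen D);
  diffusion_pos_def : forall x i, pos_def (diffusion D x i);
  dom_compact : compact (dom D);
  dom_regular : closure (dom D)° = dom D;
  beta_gt0 : 0 < beta D;
  grid_finite : forall h, 0 < h -> finite_set (grid D h);
  grid_sub : forall h, 0 < h -> grid D h `<=` dom D;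
  grid_lattice : forall h, 0 < h -> in_lattice h (grid D h);
  grid_dense : forall e : R, 0 < e -> exists2 d : R, 0 < d &
    forall h, 0 < h -> h < d -> forall p, dom D p ->
      exists2 q, grid D h q & `|p - q| < e
}.

End Basic.

(* [nF] is the filtration, [nw] the Brownian motion, [na] the Markov chain.
   Time is a real number, but only times [t >= 0] are meaningful. *)
Record noise (R : realType) (l m : nat) := Noise {
  nd : measure_display;
  nT : measurableType nd;
  nP : probability nT R;
  nF : R -> set (set nT);
  nw : R -> nT -> 'rV[R]_l;
  na : R -> nT -> 'I_m
}.
Arguments nP {R l m} N : rename.
Arguments nF {R l m} N t _ : rename.
Arguments nw {R l m} N t w : rename.
Arguments na {R l m} N t w : rename.

Definition cadlag {R : realType} {V : normedModType R} (f : R -> V) : Prop :=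
  (forall t : R, 0 <= t -> f s @[s --> t^'+] --> f t) /\
  (forall t : R, 0 < t -> cvg (f s @[s --> t^'-])).

Section Noise.
Context {R : realType} {l m : nat}.
Implicit Types (N : noise R l m) (D : game R l m).

Definition is_filtration N : Prop :=
  [/\ forall t : R, 0 <= t -> sigma_algebra setT (nF N t),
      forall t : R, 0 <= t -> nF N t `<=` measurable &
      forall s t : R, 0 <= s -> s <= t -> nF N s `<=` nF N t].

Definition adapted_at N (t : R) {d} {T : measurableType d}
    (f : nT N -> T) : Prop :=
  forall B : set T, measurable B -> nF N t (f @^-1` B).
Arguments adapted_at N t {d T} f.

(* Standard Brownian motion relative to the filtration: the increment after
   [s] is independent of the events up to [s] and has independent centered
   normal coordinates of variance [t - s]. *)
Definition is_brownian N : Prop :=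
  [/\ forall w, nw N 0 w = 0,
      forall w, {within [set t | 0 <= t], continuous (fun t => nw N t w)},
      forall (t : R) (j : 'I_l), 0 <= t ->
        adapted_at N t (fun w => nw N t w 0 j : R) &
      forall s t : R, 0 <= s -> s < t ->
      forall (A : set (nT N)) (B : 'I_l -> set R), nF N s A ->
      (forall j, measurable (B j)) ->
      nP N (A `&` [set w | forall j, B j (nw N t w 0 j - nw N s w 0 j)]) =
      (nP N A * \prod_(j < l) normal_prob 0 (Num.sqrt (t - s)) (B j))%E].

(* Entries of the matrix exponential of [s Q]. *)
Definition transition_semigroup (Q : 'M[R]_m) (s : R) (i j : 'I_m) : R :=
  limn (series (fun n => s ^+ n / n`!%:R * (Q ^+ n) i j)).

Definition is_markov_chain (Q : 'M[R]_m) N : Prop :=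
  [/\ forall w, cadlag (fun t => (na N t w)%:R : R^o),
      forall (t : R) (i : 'I_m), 0 <= t -> nF N t [set w | na N t w = i] &
      forall t s : R, 0 <= t -> 0 <= s ->
      forall (A : set (nT N)) (i j : 'I_m), nF N t A ->
      nP N (A `&` [set w | na N t w = i] `&` [set w | na N (t + s) w = j]) =
      (nP N (A `&` [set w | na N t w = i]) *
        (transition_semigroup Q s i j)%:E)%E].

Definition is_noise (Q : 'M[R]_m) N : Prop :=
  [/\ is_filtration N, is_brownian N & is_markov_chain Q N].

Definition ordinary_control N (U : set R) (u : R -> nT N -> R) : Prop :=
  (forall (t : R) w, 0 <= t -> U (u t w)) /\
  (forall t : R, 0 <= t -> adapted_at N t (u t)).

(* A random measure on [U x [0, oo)], extended by zero to [R x R]. *)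
Definition random_measure N := nT N -> {measure set (R * R) -> \bar R}.

Definition relaxed_control N (U : set R) (mu : random_measure N) : Prop :=
  [/\ forall w, mu w (~` (U `*` [set t : R | 0 <= t])) = 0%E,
      forall w (t : R), 0 <= t -> mu w (U `*` `[0, t]) = t%:E &
      forall (t : R) (B : set R), 0 <= t -> measurable B ->
        adapted_at N t (T := \bar R) (fun w => mu w (B `*` `[0, t]))].

(* [mu (dr dt) = md t (dr) dt] *)
Definition disintegration (mu : {measure set (R * R) -> \bar R})
    (md : R -> probability R R) : Prop :=
  (forall B : set R, measurable B ->
     measurable_fun [set s : R | 0 <= s] (fun s => md s B)) /\
  (forall (B : set R) (t : R), measurable B -> 0 <= t ->
     mu (B `*` `[0, t]) = (\int[lebesgue_measure]_(s in `[0%R, t]) md s B)%E).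

(* The outer measure spares measurability side conditions; on measurable
   sets it is the probability itself. *)
Definition cvg0_in_probability N (Y : nat -> nT N -> \bar R) : Prop :=
  forall e : R, 0 < e ->
    (fun n => mu_ext (nP N) [set w | (e%:E <= Y n w)%E]) @ \oo --> 0%E.

(* The simple process with value [sp_val i] on [(sp_time i, sp_time (i+1)]],
   for [i < sp_size]. *)
Record simple_process N := SimpleProcess {
  sp_size : nat;
  sp_time : nat -> R;
  sp_val : nat -> nT N -> R
}.

Definition is_simple N (t : R) (S : simple_process N) : Prop :=
  [/\ sp_time S 0 = 0, sp_time S (sp_size S) = t,
      forall i, (i < sp_size S)%N -> sp_time S i <= sp_time S i.+1,
      forall i, (i < sp_size S)%N -> adapted_at N (sp_time S i) (sp_val S i) &
      forall i, (i < sp_size S)%N -> exists M, forall w, `|sp_val S i w| <= M].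

Definition simple_value N (S : simple_process N) (s : R) (w : nT N) : R :=
  \sum_(i < sp_size S)
    sp_val S i w * \1_(`]sp_time S i, sp_time S i.+1]%classic) s.

Definition simple_integral N (S : simple_process N) (B : R -> nT N -> R)
    (w : nT N) : R :=
  \sum_(i < sp_size S)
    sp_val S i w * (B (sp_time S i.+1) w - B (sp_time S i) w).

(* [I] is (a version of) the Ito integral of [H] against [B] over [[0, t]]. *)
Definition is_ito_integral N (B H : R -> nT N -> R) (t : R)
    (I : nT N -> R) : Prop :=
  {ae nP N, forall w, measurable_fun `[0, t] (fun s => H s w) /\
     (\int[lebesgue_measure]_(s in `[0%R, t]) ((H s w) ^+ 2)%:E < +oo)%E} /\
  exists S : nat -> simple_process N,
    [/\ forall n, is_simple t (S n),
        cvg0_in_probability (fun n w => \int[lebesgue_measure]_(s in `[0%R, t])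
          ((simple_value (S n) s w - H s w) ^+ 2)%:E)%E &
        cvg0_in_probability
          (fun n w => `|simple_integral (S n) B w - I w|%:E)].

(* [dX = f dt + sigma(X, alpha) dw], [X 0 = x], for a drift process [f]. *)
Definition solves_with_drift D N (x : 'rV[R]_l) (X : R -> nT N -> 'rV[R]_l)
    (f : R -> nT N -> 'I_l -> R) : Prop :=
  [/\ forall w, X 0 w = x,
      forall w, {within [set t | 0 <= t], continuous (fun t => X t w)},
      forall (t : R) (j : 'I_l), 0 <= t ->
        adapted_at N t (fun w => X t w 0 j : R) &
      forall (t : R) (j : 'I_l), 0 <= t ->
        {ae nP N, forall w,
           lebesgue_measure.-integrable `[0, t] (fun s => (f s w j)%:E)} /\
        exists I : 'I_l -> nT N -> R,
          (forall k, is_ito_integral (fun s w => nw N s w 0 k)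
             (fun s w => sigma D (X s w) (na N s w) j k) t (I k)) /\
          {ae nP N, forall w, X t w 0 j =
             x 0 j + \int[lebesgue_measure]_(s in `[0%R, t]) f s w j
             + \sum_(k < l) I k w}].

Definition solves D N (u1 u2 : R -> nT N -> R) (x : 'rV[R]_l)
    (X : R -> nT N -> 'rV[R]_l) : Prop :=
  solves_with_drift D x X
    (fun s w j => drift D (X s w) (na N s w) (u1 s w) (u2 s w) 0 j).

Definition solves_relaxed D N (mu1 mu2 : random_measure N) (x : 'rV[R]_l)
    (X : R -> nT N -> 'rV[R]_l) : Prop :=
  exists md1 md2 : nT N -> R -> probability R R,
    [/\ forall w, disintegration (mu1 w) (md1 w),
        forall w, disintegration (mu2 w) (md2 w),
        {ae nP N, forall w, {ae lebesgue_measure, forall s : R, 0 <= s ->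
          forall j, (md1 w s \x md2 w s)%E.-integrable (act1 D `*` act2 D)
            (fun r => (drift D (X s w) (na N s w) r.1 r.2 0 j)%:E)}} &
        solves_with_drift D x X (fun s w j =>
          \int[md1 w s]_(r1 in act1 D) \int[md2 w s]_(r2 in act2 D)
            drift D (X s w) (na N s w) r1 r2 0 j)].

(* Laws of [(w, alpha, m)] and of [(x, w, alpha, m)] are compared through all
   finite families of the following coordinates, which generate the Borel
   sigma-algebras of the path spaces and of the spaces of relaxed controls. *)
Inductive coordinate :=
  | CoordW of R & 'I_l
  | CoordA of R
  | CoordM1 of set R & R
  | CoordM2 of set R & R
  | CoordX of R & 'I_l.

Definition coordinate_ok (c : coordinate) : Prop :=
  match c with
  | CoordW t _ | CoordA t | CoordX t _ => 0 <= t
  | CoordM1 B t | CoordM2 B t => measurable B /\ 0 <= t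
  end.

Definition not_state (c : coordinate) : Prop :=
  match c with CoordX _ _ => False | _ => True end.

Definition coordinate_value N (mu1 mu2 : random_measure N)
    (X : R -> nT N -> 'rV[R]_l) (c : coordinate) (w : nT N) : \bar R :=
  match c with
  | CoordW t j => (nw N t w 0 j)%:E
  | CoordA t => ((na N t w)%:R)%:E
  | CoordM1 B t => mu1 w (B `*` `[0, t])
  | CoordM2 B t => mu2 w (B `*` `[0, t])
  | CoordX t j => (X t w 0 j)%:E
  end.

Definition same_law N N' (C : set coordinate) (Y : coordinate -> nT N -> \bar R)
    (Y' : coordinate -> nT N' -> \bar R) : Prop :=
  forall (n : nat) (c : 'I_n -> coordinate) (B : 'I_n -> set (\bar R)),
    (forall k, C (c k)) -> (forall k, measurable (B k)) ->
    nP N [set w | forall k, B k (Y (c k) w)] =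
    nP N' [set w | forall k, B k (Y' (c k) w)].

Definition admissible_triple D N (mu1 mu2 : random_measure N) : Prop :=
  [/\ is_noise (gen D) N, relaxed_control (act1 D) mu1 &
      relaxed_control (act2 D) mu2].

Definition same_law_triple N N' (mu1 mu2 : random_measure N)
    (mu1' mu2' : random_measure N') : Prop :=
  same_law (coordinate_ok `&` not_state)
    (coordinate_value mu1 mu2 (fun _ _ => 0))
    (coordinate_value mu1' mu2' (fun _ _ => 0)).

Definition weak_existence D : Prop :=
  forall N (mu1 mu2 : random_measure N) (x : 'rV[R]_l),
    admissible_triple D mu1 mu2 -> dom D x ->
    exists (N' : noise R l m) (mu1' mu2' : random_measure N')
           (X' : R -> nT N' -> 'rV[R]_l),
      [/\ admissible_triple D mu1' mu2', same_law_triple mu1 mu2 mu1' mu2' &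
          solves_relaxed D mu1' mu2' x X'].

Definition weak_uniqueness D : Prop :=
  forall N N' (mu1 mu2 : random_measure N) (mu1' mu2' : random_measure N')
    (x : 'rV[R]_l) X X',
    admissible_triple D mu1 mu2 -> admissible_triple D mu1' mu2' ->
    dom D x -> same_law_triple mu1 mu2 mu1' mu2' ->
    solves_relaxed D mu1 mu2 x X -> solves_relaxed D mu1' mu2' x X' ->
    same_law coordinate_ok (coordinate_value mu1 mu2 X)
      (coordinate_value mu1' mu2' X').

Definition exit_time (G : set 'rV[R]_l) (phi : R -> 'rV[R]_l) : \bar R :=
  ereal_inf [set t%:E | t in [set t : R | 0 <= t /\ ~ G° (phi t)]].

Definition time_change (lam : R -> R) : Prop :=
  [/\ lam 0 = 0, forall s t : R, 0 <= s -> s < t -> lam s < lam t &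
      forall t : R, 0 <= t -> exists2 s, 0 <= s & lam s = t].

(* Convergence of sequences in [D[0, oo)]; the topology being metrizable, it
   determines continuity. *)
Definition skorohod_cvg (phi_ : nat -> R -> 'rV[R]_l) (phi : R -> 'rV[R]_l)
    : Prop :=
  exists lam : nat -> R -> R,
    [/\ forall n, time_change (lam n),
        forall e : R, 0 < e -> \forall n \near \oo,
          forall t : R, 0 <= t -> `|lam n t - t| <= e &
        forall T e : R, 0 < e -> \forall n \near \oo,
          forall t : R, 0 <= t -> t <= T -> `|phi_ n (lam n t) - phi t| <= e].

Definition skorohod_continuous_at (F : (R -> 'rV[R]_l) -> \bar R)
    (phi : R -> 'rV[R]_l) : Prop :=
  forall phi_ : nat -> R -> 'rV[R]_l, (forall n, cadlag (phi_ n)) ->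
    skorohod_cvg phi_ phi -> F (phi_ n) @[n --> \oo] --> F phi.

End Noise.

Section Assumptions.
Context {R : realType} {l m : nat}.
Variable D : game R l m.
Local Notation G := (dom D).
Local Notation U1 := (act1 D).
Local Notation U2 := (act2 D).

Definition A1 : Prop := forall i : 'I_m,
  {within G `*` (U1 `*` U2),
    continuous (fun z : 'rV[R]_l * (R * R) => kcost D z.1 i z.2.1 z.2.2)} /\
  {within G `*` (U1 `*` U2),
    continuous (fun z : 'rV[R]_l * (R * R) => drift D z.1 i z.2.1 z.2.2)}.

Definition A2 : Prop := forall i : 'I_m,
  {within G, continuous (sigma D ^~ i)} /\
  {within G, continuous (gcost D ^~ i)}.

Definition A3 : Prop := weak_existence D /\ weak_uniqueness D.

Definition A4 : Prop := forall x (i : 'I_m) (j : 'I_l), G x ->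
  diffusion D x i j j > \sum_(k | k != j) `|diffusion D x i j k|.

Definition A5 : Prop :=
  forall (N : noise R l m) (u1 u2 : R -> nT N -> R) x (i : 'I_m) X,
    is_noise (gen D) N -> ordinary_control U1 u1 -> ordinary_control U2 u2 ->
    G x -> (forall w, na N 0 w = i) -> solves D u1 u2 x X ->
    {ae nP N, forall w,
       skorohod_continuous_at (exit_time G) (fun t => X t w)}.

Definition A6 : Prop :=
  exists (b1 b2 : 'rV[R]_l -> 'I_m -> R -> 'rV[R]_l)
         (k1 k2 : 'rV[R]_l -> 'I_m -> R -> R),
  forall x i r1 r2, G x -> U1 r1 -> U2 r2 ->
    drift D x i r1 r2 = b1 x i r1 + b2 x i r2 /\
    kcost D x i r1 r2 = k1 x i r1 + k2 x i r2.

Definition A7 : Prop :=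
  [/\ convex_set (U1 : set R^o), convex_set (U2 : set R^o),
      forall x i r2, G x -> U2 r2 ->
        convex_function (U1 : set R^o) (fun r1 : R^o => kcost D x i r1 r2),
      forall x i r1, G x -> U1 r1 ->
        convex_function (U2 : set R^o) (fun r2 : R^o => - kcost D x i r1 r2) &
      exists b0 b1 b2 b3 : 'rV[R]_l -> 'I_m -> 'rV[R]_l,
        (forall i, [/\ {within G, continuous (b0 ^~ i)},
                       {within G, continuous (b1 ^~ i)},
                       {within G, continuous (b2 ^~ i)} &
                       {within G, continuous (b3 ^~ i)}]) /\
        forall x i r1 r2, G x -> U1 r1 -> U2 r2 ->
          drift D x i r1 r2 =
            (r1 * r2) *: b0 x i + r1 *: b1 x i + r2 *: b2 x i + b3 x i].

End Assumptions.

Section Chain.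
Context {R : realType} {l m : nat}.
Variables (D : game R l m) (h : R).
Implicit Types (x y : 'rV[R]_l) (i : 'I_m).

Definition state : Type := ('rV[R]_l * 'I_m)%type.

Definition neighbour x y : Prop :=
  (exists (j : 'I_l) (s : bool), y = x + (-1) ^+ s *: (h *: unitv j)) \/
  (exists (j k : 'I_l) (s s' : bool), j != k /\
     y = x + (-1) ^+ s *: (h *: unitv j) + (-1) ^+ s' *: (h *: unitv k)).

Definition grid_int : set 'rV[R]_l :=
  [set x | [/\ grid D h x, (dom D)° x & forall y, neighbour x y -> grid D h y]].

Definition normalizer x i : R :=
  let a := diffusion D x i in
  \sum_j a j j - \sum_(j < l) \sum_(k < l | (j < k)%N) `|a j k|
  - gen D i i * h ^+ 2 + beta D * h ^+ 2.

Definition time_step x i : R := h ^+ 2 / normalizer x i.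

(* The target points listed below are pairwise distinct, so that at most one
   of the indicators is nonzero. *)
Definition trans (z z' : state) (r1 r2 : R) : R :=
  let: (x, i) := z in let: (y, i') := z' in
  let a := diffusion D x i in
  let b := drift D x i r1 r2 in
  let d := normalizer x i - beta D * h ^+ 2 in
  let e (j : 'I_l) : 'rV[R]_l := h *: unitv j in
  (i' == i)%:R *
  (\sum_(j < l)
      ((y == x + e j)%:R * ((h * b 0 j + dominance a j) / (2 * d)) +
       (y == x - e j)%:R * ((- h * b 0 j + dominance a j) / (2 * d))) +
   \sum_(j < l) \sum_(k < l | (j < k)%N)
      ((y == x + e j + e k)%:R + (y == x - e j - e k)%:R) *
      (2^-1 * Num.max (a j k) 0 / d) +
   \sum_(j < l) \sum_(k < l | j != k)
      (y == x + e j - e k)%:R * (2^-1 * Num.max (- a j k) 0 / d)) +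
  ((y == x) && (i' != i))%:R * (gen D i i' * h ^+ 2 / d).

Definition stopped_trans (z z' : state) (r1 r2 : R) : R :=
  if `[< grid_int z.1 >] then trans z z' r1 r2 else `[< z' = z >]%:R.

(* [c n s own opp] is the action at step [n], given the states at times
   [<= n], the player's own actions at times [< n] and the opponent's actions
   at times [<= n].  The states take finitely many values, so measurability
   bears on the actions only.  The player who goes first has the controls that
   ignore the opponent's action at time [n]. *)
Definition control : Type :=
  forall n : nat, n.+1.-tuple state -> n.-tuple R -> n.+1.-tuple R -> R.

Definition goes_last (U : set R) : set control :=
  [set c | (forall n s own opp, U (c n s own opp)) /\
     forall n s, measurable_fun setT
       (fun v : n.-tuple R * n.+1.-tuple R => c n s v.1 v.2)].

Definition goes_first (U : set R) : set control :=
  [set c | goes_last U c /\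
     forall n s own (opp opp' : n.+1.-tuple R),
       take n opp = take n opp' -> c n s own opp = c n s own opp'].

Record process := Process {
  pd : measure_display;
  pT : measurableType pd;
  pP : probability pT R;
  pX : nat -> pT -> state;
  pu1 : nat -> pT -> R;
  pu2 : nat -> pT -> R
}.
Arguments pX : clear implicits.
Arguments pu1 : clear implicits.
Arguments pu2 : clear implicits.

Definition cylinder (Y : process) (n : nat) (s : nat -> state) : set (pT Y) :=
  [set w | forall k, (k <= n)%N -> pX Y k w = s k].
Arguments cylinder : clear implicits.

(* The chain started at [z] and controlled by [c1], [c2].  As the actions are
   functions of the past states, the last clause is the conditional law of the
   next state given the past states and the actions up to now. *)
Record controlled_chain (z : state) (c1 c2 : control) (Y : process) : Prop :=
  ControlledChain {
  chain_measurable : forall n s, measurable [set w | pX Y n w = s];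
  chain_grid : forall n w, grid D h (pX Y n w).1;
  chain_init : forall w, pX Y 0 w = z;
  chain_u1 : forall n w, pu1 Y n w =
    c1 n [tuple pX Y k w | k < n.+1] [tuple pu1 Y k w | k < n]
      [tuple pu2 Y k w | k < n.+1];
  chain_u2 : forall n w, pu2 Y n w =
    c2 n [tuple pX Y k w | k < n.+1] [tuple pu2 Y k w | k < n]
      [tuple pu1 Y k w | k < n.+1];
  chain_trans : forall n s, pP Y (cylinder Y n.+1 s) =
    (\int[pP Y]_(w in cylinder Y n s)
       (stopped_trans (s n) (s n.+1) (pu1 Y n w) (pu2 Y n w))%:E)%E
}.

(* [N_h], with [None] for the value infinity *)
Definition exit_step (X : nat -> state) : option nat :=
  match pselect (exists n, `[< ~ grid_int (X n).1 >]) with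
  | left ex => Some (ex_minn ex)
  | right _ => None
  end.

Definition elapsed (X : nat -> state) (n : nat) : R :=
  \sum_(k < n) time_step (X k).1 (X k).2.

Definition running (X : nat -> state) (u1 u2 : nat -> R) (n : nat) : R :=
  expR (- beta D * elapsed X n) * kcost D (X n).1 (X n).2 (u1 n) (u2 n)
  * time_step (X n).1 (X n).2.

Definition path_cost (X : nat -> state) (u1 u2 : nat -> R) : R :=
  match exit_step X with
  | Some N => \sum_(n < N) running X u1 u2 n + gcost D (X N).1 (X N).2
  | None => limn (series (running X u1 u2))
  end.

Definition expected_cost (Y : process) : \bar R :=
  'E_(pP Y)[fun w => path_cost (pX Y ^~ w) (pu1 Y ^~ w) (pu2 Y ^~ w)].

(* A choice, for each initial state and pair of controls one of which goes
   first and the other last, of a chain with these controls.  Pairs of other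
   kinds need not determine the actions. *)
Definition chain_family (Y : state -> control -> control -> process) : Prop :=
  forall z c1 c2, grid D h z.1 ->
    (goes_first (act1 D) c1 /\ goes_last (act2 D) c2) \/
    (goes_last (act1 D) c1 /\ goes_first (act2 D) c2) ->
    controlled_chain z c1 c2 (Y z c1 c2).

Variable Y : state -> control -> control -> process.

Definition upper_value (z : state) : \bar R :=
  ereal_inf [set ereal_sup [set expected_cost (Y z c1 c2)
    | c2 in goes_last (act2 D)] | c1 in goes_first (act1 D)].

Definition lower_value (z : state) : \bar R :=
  ereal_sup [set ereal_inf [set expected_cost (Y z c1 c2)
    | c1 in goes_last (act1 D)] | c2 in goes_first (act2 D)].

End Chain.

Arguments state R l m : clear implicits.
Arguments control R l m : clear implicits.
Arguments process R l m : clear implicits.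
Arguments pP {R l m} p : rename.
Arguments pX {R l m} p n w : rename.
Arguments pu1 {R l m} p n w : rename.
Arguments pu2 {R l m} p n w : rename.
Arguments cylinder {R l m} Y n s w.

(* Main.v *)
Require Import Defs.
From mathcomp Require Import ring lra.
Set Implicit Arguments.
Unset Strict Implicit.
Unset Printing Implicit Defensive.
Local Open Scope classical_set_scope.
Local Open Scope ring_scope.

(** The terminal cost is not discounted, and the players together, or one of them
    alone, may be able to keep the chain inside the grid forever, which pays no
    terminal cost.  The dynamic programming operator therefore need not be a
    contraction and may have several fixed points; the proof has to single out the
    right one and to show that both players can approach it.

    The one-step games have saddle points in pure actions ([payoff_saddle]): the
    transition probabilities are affine in the drift ([trans_affine]), so the
    one-step payoff is separable, or continuous and convex-concave on a product of
    compact intervals, where the minimax theorem is elementary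
    ([saddle_convex_concave]).

    The running cost is discounted and the time steps are bounded below, so the
    running cost after a large number of steps is negligible.  What remains is a
    recursive game in the sense of Everett: terminal payoff on exit, and 0
    otherwise.  Its value from below is the supremum of the functions that the
    maximizer can turn into submartingales with a positive drift wherever they are
    positive; its value from above is the corresponding infimum.  Both are fixed
    points of the one-step value operator, and they agree
    ([recursive_game_determined]).  If they did not, look at the set where their
    difference is maximal.  There the upper value is positive somewhere or the lower
    value is negative somewhere.  In the first case the upper value can be lowered
    slightly where it is largest in this set without losing its defining property,
    because the minimizer's optimal action against the lower value also controls the
    upper one ([gap_argmax_upper_le0]); the second case is dual.

    Dynamic programming over [N] steps with these functions as terminal values
    produces, for each player, a potential with a strategy, and the potentials of
    the two players are arbitrarily close ([potentials_meet]).  Under the strategy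
    of a potential, accumulated cost plus potential is a submartingale whatever
    the opponent does, and the positive drift makes the potential of the surviving
    paths disappear in the limit; so the expected cost is at least the initial
    potential ([potential_le_cost]).  As strategies of potentials ignore the
    actions, they are available to a player who goes first, and the upper and lower
    values are squeezed together ([grid_game_value]). *)

(** * Saddle points of separable and of convex-concave payoffs *)

Section SaddlePoints.
Context {R : realType}.
Implicit Types (U V : set R) (p q : R -> R) (f : R -> R -> R).

Definition saddle_point U V f : Prop :=
  exists r s, [/\ U r, V s, forall r', U r' -> f r s <= f r' s &
    forall s', V s' -> f r s' <= f r s].

Lemma saddle_separable U V f (f1 f2 : R -> R) :
  compact U -> compact V -> U !=set0 -> V !=set0 ->
  (forall s, V s -> {within U, continuous (f ^~ s)}) ->
  (forall r, U r -> {within V, continuous (f r)}) ->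
  (forall r s, U r -> V s -> f r s = f1 r + f2 s) ->
  saddle_point U V f.
Proof.
move=> cU cV [r0 Ur0] [s0 Vs0] fU fV fE.
have [] := compact_EVT_min (ex_intro _ r0 Ur0) cU (fU _ Vs0).
move=> r; rewrite inE => Ur rmin.
have [] := compact_EVT_max (ex_intro _ s0 Vs0) cV (fV _ Ur0).
move=> s; rewrite inE => Vs smax.
exists r, s; split=> // [r' Ur'|s' Vs'].
  by have := rmin r' (mem_set Ur'); rewrite !fE// !lerD2r.
by have := smax s' (mem_set Vs'); rewrite !fE// !lerD2l.
Qed.

Definition segment_closed U := forall x y t : R, U x -> U y ->
  0 <= t -> t <= 1 -> U (t * x + (1 - t) * y).

Definition concave_on U p := forall x y t : R, U x -> U y ->
  0 <= t -> t <= 1 -> t * p x + (1 - t) * p y <= p (t * x + (1 - t) * y).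

(** Separation in the plane: the image of [V] under [(p, q)] avoids the closed
    quadrant, and [t] is the slope of a line through the origin that separates
    them.  The slope is the supremum of the ratios [p y / - q y] over the points
    with [0 <= p y]; concavity makes each of them at most every ratio obtained
    from a point with [0 <= q y], since otherwise some point of the segment
    between the two would land in the quadrant. *)
Lemma concave_alternative V p q : segment_closed V ->
  concave_on V p -> concave_on V q ->
  (exists2 y, V y & 0 <= p y) -> (exists2 y, V y & 0 < q y) ->
  (forall y, V y -> p y < 0 \/ q y < 0) ->
  exists t, [/\ 0 <= t, t <= 1 & forall y, V y -> t * p y + (1 - t) * q y <= 0].
Proof.
move=> sV cp cq [y1 Vy1 py1] [y2 Vy2 qy2] pq.
have cross x y : V x -> V y -> 0 <= p x -> 0 <= q y ->
    p x * q y <= (- q x) * (- p y).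
  move=> Vx Vy px qy.
  have qx : q x < 0 by case: (pq x Vx) => //; rewrite ltNge px.
  have py : p y < 0 by case: (pq y Vy) => //; rewrite (ltNge (q y)) qy.
  rewrite leNgt; apply/negP => h.
  have d0 : 0 < q y - q x by lra.
  pose t := q y / (q y - q x).
  have tE : t * (q y - q x) = q y by rewrite /t divfK// gt_eqF.
  have t0 : 0 <= t by rewrite /t divr_ge0// ltW.
  have t1 : t <= 1 by rewrite /t ler_pdivrMr; lra.
  have hp := cp x y t Vx Vy t0 t1; have hq := cq x y t Vx Vy t0 t1.
  have := pq _ (sV x y t Vx Vy t0 t1).
  have hq0 : 0 <= t * q x + (1 - t) * q y by lra.
  have hp0 : 0 <= t * p x + (1 - t) * p y.
    rewrite -(pmulr_rge0 _ d0).
    have -> : (q y - q x) * (t * p x + (1 - t) * p y) =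
      p x * (t * (q y - q x)) + p y * ((q y - q x) - t * (q y - q x)) by ring.
    by rewrite tE; lra.
  by case; lra.
pose A := [set p y / - q y | y in [set y | V y /\ 0 <= p y]].
have qN y : V y -> 0 <= p y -> q y < 0.
  by move=> Vy py; case: (pq y Vy) => //; rewrite ltNge py.
have supA : has_sup A.
  split; first by exists (p y1 / - q y1), y1.
  exists (- p y2 / q y2) => _ [y [Vy py] <-].
  have qy := qN y Vy py.
  rewrite ler_pdivlMr// mulrAC ler_pdivrMr ?oppr_gt0//.
  by rewrite [leRHS]mulrC; apply: cross => //; exact: ltW.
pose th := sup A.
have thA y : V y -> 0 <= p y -> p y <= th * - q y.
  move=> Vy py; rewrite -ler_pdivrMr ?oppr_gt0; last exact: qN.
  by apply: ub_le_sup; [case: supA|exists y].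
have th0 : 0 <= th.
  have := thA y1 Vy1 py1; have := qN y1 Vy1 py1 => h1 h2.
  by rewrite -(@pmulr_lge0 _ (- q y1)) ?oppr_gt0//; lra.
have neg y : V y -> p y + th * q y <= 0.
  move=> Vy; have [py|py] := leP 0 (p y); first by have := thA y Vy py; lra.
  have [qy|qy] := leP (q y) 0.
    by have : th * q y <= 0 by [rewrite mulr_ge0_le0|]; lra.
  have th_le : th <= - p y / q y.
    apply: ge_sup; first by case: supA.
    move=> _ [x [Vx px] <-]; rewrite ler_pdivlMr// mulrAC ler_pdivrMr.
      by rewrite [leRHS]mulrC; apply: cross => //; exact: ltW.
    by rewrite oppr_gt0 qN.
  by move: th_le; rewrite ler_pdivlMr//; lra.
have d0 : 0 < 1 + th by lra.
exists (1 / (1 + th)); split; first by rewrite divr_ge0// ltW.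
  by rewrite ler_pdivrMr; lra.
move=> y Vy; have := neg y Vy.
have -> : 1 / (1 + th) * p y + (1 - 1 / (1 + th)) * q y
   = (p y + th * q y) / (1 + th) by field; lra.
by move=> h; rewrite pmulr_lle0// invr_gt0.
Qed.

(** If no point served both functions, the separating combination given by
    [concave_alternative] at a level slightly below [v] would stay below [v]
    everywhere. *)
Lemma concave_pair V p q (v : R) : compact V -> segment_closed V ->
  concave_on V p -> concave_on V q ->
  {within V, continuous p} -> {within V, continuous q} ->
  (forall t, 0 <= t -> t <= 1 ->
     exists2 y, V y & v <= t * p y + (1 - t) * q y) ->
  exists y, [/\ V y, v <= p y & v <= q y].
Proof.
move=> cV sV kp kq cp cq H.
have V0 : V !=set0 by have [y Vy _] := H 0 (lexx _) ler01; exists y.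
have cm : {within V, continuous (fun y => Num.min (p y) (q y))}.
  move=> y; apply: continuous_min; [exact: cp|exact: cq].
have [y0] := compact_EVT_max V0 cV cm; rewrite inE => Vy0 ymax.
have [vm|mv] := leP v (Num.min (p y0) (q y0)).
  by exists y0; move: vm; rewrite le_min => /andP[].
exfalso; set m := Num.min _ _ in mv ymax.
pose v' := (m + v) / 2.
have shift r : concave_on V r -> concave_on V (fun y => r y - v').
  by move=> cr x y t Vx Vy t0 t1; have := cr x y t Vx Vy t0 t1; lra.
have [|||||t [t0 t1 tP]] :=
  @concave_alternative V (fun y => p y - v') (fun y => q y - v') sV.
- exact: shift.
- exact: shift.
- have [y Vy] := H 1 ler01 (lexx _) => hy; exists y => //.
  by move: hy; rewrite /v'; lra.
- have [y Vy] := H 0 (lexx _) ler01 => hy; exists y => //.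
  by move: hy; rewrite /v'; lra.
- move=> y Vy; have := ymax y (mem_set Vy); rewrite ge_min /v'.
  by move=> /orP[h|h]; [left|right]; lra.
have [y Vy] := H t t0 t1; have := tP y Vy.
have -> : t * (p y - v') + (1 - t) * (q y - v') = t * p y + (1 - t) * q y - v'.
  by ring.
by rewrite /v'; lra.
Qed.

(** The superlevel sets [{s | v <= f r s}] are compact intervals, and by
    [concave_pair] any two of them meet.  By Helly's theorem on the line they
    have a common point, namely the supremum of their left endpoints. *)
Lemma convex_concave_common U V f (v : R) : U !=set0 -> segment_closed U ->
  compact V -> segment_closed V ->
  (forall r, U r -> {within V, continuous (f r)}) ->
  (forall s, V s -> concave_on U (fun r => - f r s)) ->
  (forall r, U r -> concave_on V (f r)) ->
  (forall r, U r -> exists2 s, V s & v <= f r s) ->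
  exists2 s, V s & forall r, U r -> v <= f r s.
Proof.
move=> [r0 Ur0] sU cV sV fV fU kV H.
have pairP r r' : U r -> U r' -> exists s, [/\ V s, v <= f r s & v <= f r' s].
  move=> Ur Ur'; apply: concave_pair => //; [exact: kV|exact: kV|exact: fV|exact: fV|].
  move=> t t0 t1; have [s Vs hs] := H _ (sU _ _ _ Ur Ur' t0 t1).
  by exists s => //; have := fU s Vs r r' t Ur Ur' t0 t1; lra.
pose A r := [set s | V s /\ v <= f r s].
have cA r : U r -> compact (A r).
  move=> Ur.
  have : closed (f r @^-1` [set x | v <= x] : set (subspace V)).
    by apply: preimage_closed; [move=> x _; exact: fV|exact: closed_ge].
  move=> /closed_subspaceP[B cB BE].
  rewrite (_ : A r = V `&` B); first exact: compact_closedI.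
  by rewrite setIC BE; apply/seteqP; split=> s [].
have ex_min r : U r -> exists2 s, A r s & forall s', A r s' -> s <= s'.
  move=> Ur; have [s Vs hs] := H r Ur.
  have [s'] := compact_EVT_min (ex_intro (A r) s (conj Vs hs)) (cA r Ur)
    (continuous_subspaceT (fun x => @cvg_id R (nbhs x))).
  rewrite inE => As' smin; exists s' => // s'' As''.
  by apply: smin; rewrite inE.
have ex_max r : U r -> exists2 s, A r s & forall s', A r s' -> s' <= s.
  move=> Ur; have [s Vs hs] := H r Ur.
  have [s'] := compact_EVT_max (ex_intro (A r) s (conj Vs hs)) (cA r Ur)
    (continuous_subspaceT (fun x => @cvg_id R (nbhs x))).
  rewrite inE => As' smin; exists s' => // s'' As''.
  by apply: smin; rewrite inE.
pose L := [set s | exists2 r, U r & A r s /\ forall s', A r s' -> s <= s'].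
have L0 : L !=set0 by have [s As smin] := ex_min r0 Ur0; exists s, r0.
have Lub r s : U r -> A r s -> (forall s', A r s' -> s' <= s) -> ubound L s.
  move=> Ur Ars rmax s' [r' Ur' [Ar's' r'min]].
  have [s'' [Vs'' h1 h2]] := pairP r r' Ur Ur'.
  by apply: (le_trans (r'min s'' _)) => //; exact: rmax.
have supL : has_sup L.
  have [s As smax] := ex_max r0 Ur0.
  by split=> //; exists s; exact: (Lub _ _ _ _ smax).
have main r : U r -> A r (sup L).
  move=> Ur; have [s1 [V1 f1] smin] := ex_min r Ur.
  have [s2 [V2 f2] smax] := ex_max r Ur.
  have h1 : s1 <= sup L by apply: ub_le_sup; [case: supL|exists r].
  have h2 : sup L <= s2 by apply: ge_sup => //; exact: (Lub _ _ _ _ smax).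
  have [->|s12] := eqVneq (sup L) s2; first by [].
  have d0 : 0 < s2 - s1.
    by rewrite subr_gt0; apply: (le_lt_trans h1); rewrite lt_neqAle s12.
  pose t := (s2 - sup L) / (s2 - s1).
  have t0 : 0 <= t by apply: divr_ge0; lra.
  have t1 : t <= 1 by rewrite /t ler_pdivrMr//; lra.
  (* [sup L] lies between the extreme points of [A r], which is convex *)
  have -> : sup L = t * s1 + (1 - t) * s2 by rewrite /t; field; lra.
  split; first exact: sV.
  apply: le_trans (kV r Ur s1 s2 t V1 V2 t0 t1).
  have -> : v = t * v + (1 - t) * v by ring.
  by apply: lerD; rewrite ler_wpM2l// subr_ge0.
by exists (sup L) => [|r /main[]//]; have [] := main r0 Ur0.
Qed.

(** Both players can secure the lower value [sup W] with one action, by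
    [convex_concave_common] applied to the payoff and to its opposite with the
    players exchanged; two such actions form a saddle point. *)
Lemma saddle_convex_concave U V f :
  compact U -> compact V -> U !=set0 -> V !=set0 ->
  segment_closed U -> segment_closed V ->
  (forall s, V s -> {within U, continuous (f ^~ s)}) ->
  (forall r, U r -> {within V, continuous (f r)}) ->
  (forall s, V s -> concave_on U (fun r => - f r s)) ->
  (forall r, U r -> concave_on V (f r)) ->
  saddle_point U V f.
Proof.
move=> cU cV U0 V0 sU sV fU fV kU kV.
have [r0 Ur0] := U0; have [s0 Vs0] := V0.
pose W := [set v | forall r, U r -> exists2 s, V s & v <= f r s].
have W0 : W !=set0.
  have [r] := compact_EVT_min U0 cU (fU s0 Vs0); rewrite inE => Ur rmin.
  by exists (f r s0) => r' Ur'; exists s0 => //; apply: rmin; rewrite inE.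
have supW : has_sup W.
  split=> //; have [s] := compact_EVT_max V0 cV (fV r0 Ur0).
  rewrite inE => Vs smax; exists (f r0 s) => v /(_ r0 Ur0)[s' Vs' h].
  by apply: (le_trans h); apply: smax; rewrite inE.
have Wsup : W (sup W).
  move=> r Ur; have [s] := compact_EVT_max V0 cV (fV r Ur).
  rewrite inE => Vs smax; exists s => //; apply: ge_sup => //.
  move=> v /(_ r Ur)[s' Vs' h]; apply: (le_trans h).
  by apply: smax; rewrite inE.
have [s Vs sP] := convex_concave_common U0 sU cV sV fV kU kV Wsup.
have [||||r Ur rP] := @convex_concave_common V U (fun s r => - f r s) (- sup W)
  V0 sV cU sU.
- by move=> s' Vs' x; apply: continuousN; exact: fU.
- move=> r Ur x y t Vx Vy t0 t1; rewrite !opprK; exact: kV.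
- move=> s' Vs'; exact: kU.
- move=> s' Vs'; have [r] := compact_EVT_min U0 cU (fU s' Vs').
  rewrite inE => Ur rmin; exists r => //; rewrite lerN2.
  apply: ub_le_sup; first by case: supW.
  by move=> r' Ur'; exists s' => //; apply: rmin; rewrite inE.
have rs : f r s = sup W.
  by apply/le_anti; rewrite sP// andbT -lerN2; exact: rP.
exists r, s; split=> // [r' Ur'|s' Vs']; rewrite rs; first exact: sP.
by rewrite -lerN2; exact: rP.
Qed.

End SaddlePoints.

(** * Recursive games: the values from below and from above agree *)

Section RecursiveGame.
Context {R : realType} {S : finType}.
Implicit Types (I : pred S) (T : (S -> R) -> S -> R) (g V W U : S -> R).

Lemma pos_lower_bound (P : pred S) (f : S -> R) :
  (forall z, P z -> 0 < f z) -> exists2 e, 0 < e & forall z, P z -> e <= f z.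
Proof.
move=> f0; exists (\big[Num.min/1]_(z | P z) f z).
  by elim/big_ind: _ => // x y x0 y0; rewrite lt_min x0.
by move=> z Pz; rewrite (bigD1 z)//= ge_min lexx.
Qed.

Definition monotone_op T := forall W W', (forall z, W z <= W' z) ->
  forall z, T W z <= T W' z.

(** Linearity along the half-plane spanned by [W] and the constants; the value of
    a zero-sum game has this property, but is not linear. *)
Definition affine_op T := forall (s : R) W (c : R) z, 0 <= s ->
  T (fun y => s * W y + c) z = s * T W z + c.

(** The operator of the game with the players exchanged and the payoff negated. *)
Definition dual_op T : (S -> R) -> S -> R :=
  fun W z => - T (fun y => - W y) z.

Lemma dual_monotone T : monotone_op T -> monotone_op (dual_op T).
Proof.
by move=> mT W W' WW' z; rewrite lerN2; apply: mT => y; rewrite lerN2.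
Qed.

Lemma dual_affine T : affine_op T -> affine_op (dual_op T).
Proof.
move=> aT s W c z s0; rewrite /dual_op.
have -> : (fun y => - (s * W y + c)) = (fun y => s * (- W y) + (- c)).
  by apply/funext => y; ring.
by rewrite aT//; ring.
Qed.

Lemma affine_cst T (c : R) z : affine_op T -> T (fun=> c) z = c.
Proof.
move=> aT; have := aT 0 (fun=> c) c z (lexx _).
by under eq_fun do rewrite mul0r add0r; rewrite mul0r add0r.
Qed.

Lemma affine_shift T W (c : R) z : affine_op T ->
  T (fun y => W y + c) z = T W z + c.
Proof.
move=> aT; have := aT 1 W c z ler01.
by under eq_fun do rewrite mul1r; rewrite mul1r.
Qed.

(** A player who plays optimally against such a [W] makes [W] of the current state
    a submartingale whose drift is positive as long as [W] is.  Staying inside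
    forever is then worth at least [W] although it pays 0, because the drift
    excludes remaining where [W] is positive. *)
Definition submartingale I g T W : Prop :=
  (forall z, ~~ I z -> W z = g z) /\
  (forall z, I z -> W z <= T W z /\ (0 < W z -> W z < T W z)).

(** The last two clauses say that [V] is the supremum of the submartingales, and
    that a single submartingale approximates it at all states.  For the dual
    operator and [- g], [- V] is this supremum when [V] is the infimum of the
    corresponding supermartingales. *)
Definition recursive_value I g T V : Prop :=
  [/\ forall z, ~~ I z -> V z = g z,
      forall z, I z -> T V z = V z,
      forall W, submartingale I g T W -> forall z, W z <= V z &
      forall e : R, 0 < e -> exists2 W, submartingale I g T W &
        forall z, V z - e <= W z].

Lemma submartingale_max I g T W W' : monotone_op T ->
  submartingale I g T W -> submartingale I g T W' ->
  submartingale I g T (fun z => Num.max (W z) (W' z)).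
Proof.
move=> mT [Wg WT] [W'g W'T]; split=> z Iz; first by rewrite Wg// W'g// maxxx.
have TW : T W z <= T (fun z => Num.max (W z) (W' z)) z.
  by apply: mT => y; rewrite le_max lexx.
have TW' : T W' z <= T (fun z => Num.max (W z) (W' z)) z.
  by apply: mT => y; rewrite le_max lexx orbT.
have [W1 W2] := WT z Iz; have [W'1 W'2] := W'T z Iz.
by case: (leP (W z) (W' z)) => WW'; split; first exact: le_trans TW';
  first (by move=> /W'2 h; exact: lt_le_trans TW');
  first exact: le_trans TW; move=> /W2 h; exact: lt_le_trans TW.
Qed.

(** At a maximum above [M] the state is inner and [W] positive there, which forces
    a strict increase of a maximal value. *)
Lemma submartingale_bounded I g T W (M : R) : monotone_op T -> affine_op T ->
  0 <= M -> (forall z, `|g z| <= M) -> submartingale I g T W ->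
  forall z, W z <= M.
Proof.
move=> mT aT M0 gM [Wg WT] z.
have [y _ ymax] := @arg_maxP _ R S z xpredT W isT.
apply: (le_trans (ymax z isT)).
have [Iy|nIy] := boolP (I y); last first.
  by rewrite Wg//; apply: le_trans (gM y); exact: ler_norm.
rewrite leNgt; apply/negP => My.
have [_ /(_ (le_lt_trans M0 My))] := WT y Iy.
have := mT W (fun=> W y) (fun x => ymax x isT) y.
by rewrite affine_cst// => h /lt_le_trans/(_ h); rewrite ltxx.
Qed.

(** The supremum of the submartingales is attained up to [e] because they are
    closed under maxima and the states are finitely many.  It is a fixed point:
    raising a submartingale at one state to anything strictly below its image
    there keeps it a submartingale. *)
Lemma recursive_value_exists I g T : monotone_op T -> affine_op T ->
  exists V, recursive_value I g T V.
Proof.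
move=> mT aT; pose M : R := \sum_z `|g z|.
have M0 : 0 <= M by apply: sumr_ge0.
have gM z : `|g z| <= M.
  by rewrite /M (bigD1 z)//= lerDl; apply: sumr_ge0.
pose C := submartingale I g T.
pose bot z := if I z then - M else g z.
have Cbot : C bot.
  split=> z Iz; first by rewrite /bot (negbTE Iz).
  have -> : bot z = - M by rewrite /bot Iz.
  split; last by move=> h; exfalso; lra.
  rewrite -[leLHS](@affine_cst T _ z)//; apply: mT => y.
  rewrite /bot; case: ifP => // _; have := gM y; rewrite ler_norml.
  by case/andP.
pose V z := sup [set W z | W in C].
have Csup z : has_sup [set W z | W in C].
  split; first by exists (bot z), bot.
  exists M => _ [W CW <-]; exact: (@submartingale_bounded I g T).
have VC W : C W -> forall z, W z <= V z.
  by move=> CW z; apply: ub_le_sup; [case: (Csup z)|exists W].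
have Vapprox (e : R) : 0 < e -> exists2 W, C W & forall z, V z - e <= W z.
  move=> e0.
  suff [W CW WV] : exists2 W, C W & forall z, z \in enum S -> V z - e <= W z.
    by exists W => // z; apply: WV; rewrite mem_enum.
  elim: (enum S) => [|x s [W CW WV]]; first by exists bot.
  have [_ [W' CW' <-] W'V] := sup_adherent e0 (Csup x).
  exists (fun z => Num.max (W z) (W' z)); first exact: submartingale_max.
  move=> z; rewrite inE => /orP[/eqP ->|zs]; rewrite le_max.
    by rewrite (ltW W'V) orbT.
  by rewrite WV.
exists V; split=> // [z nIz|z Iz].
  rewrite /V (_ : [set _ | _ in _] = [set g z]) ?sup1//.
  apply/seteqP; split=> [_ [W [Wg _] <-]|_ ->]/=; first exact: Wg.
  by exists bot => //; rewrite /bot (negbTE nIz).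
have TVe (e : R) : 0 < e -> exists2 W, C W &
    [/\ forall y, V y - e <= W y & T V z - e <= T W z].
  move=> e0; have [W CW WV] := Vapprox e e0; exists W => //; split => //.
  by rewrite -affine_shift//; apply: mT.
apply/le_anti/andP; split; last first.
  apply/ler_addgt0Pr => e e0; have [W CW WV] := Vapprox e e0.
  rewrite -lerBlDr; apply: (le_trans (WV z)).
  apply: (le_trans (proj1 (CW.2 z Iz))); exact: mT (VC W CW) z.
apply/ler_addgt0Pr => e e0; have [W CW [WV TW]] := TVe _ e0.
rewrite -lerBlDr; apply: (le_trans TW).
rewrite leNgt; apply/negP => VTW.
pose v := (V z + T W z) / 2.
have Wz : W z <= V z := VC W CW z.
pose W' y := if y == z then v else W y.
have WW' y : W y <= W' y.
  by rewrite /W'; case: eqP => // ->; rewrite /v; lra.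
suff /VC/(_ z) : C W' by rewrite /W' eqxx /v; lra.
have [Wg WT] := CW.
split=> y Iy; first by rewrite /W'; case: eqP => [yz|_]; [rewrite yz Iz in Iy|exact: Wg].
have h := mT _ _ WW' y.
rewrite {1 3 4}/W'; case: eqP => [yz|_].
  by move: h; rewrite yz /v; split => [|_]; lra.
have [h1 h2] := WT y Iy; split; first exact: le_trans h.
by move=> /h2 h3; exact: lt_le_trans h.
Qed.

(** Here [V] is the value approximated from below and [V'] the one approximated
    from above.  Let [c > 0] be the maximum of [V' - V], attained on [Z], let [a]
    be the maximum of [V'] on [Z] and [Z'] the part of [Z] where [V' = a].  If
    [0 < a], a supermartingale close to [V'] remains one when its values on [Z']
    are replaced by a constant slightly below [a], which contradicts the
    minimality of [V'].  Indeed the new function lies below a slightly lowered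
    convex combination of [V + c] and of the constant [a]: on [Z'] both equal
    [V']; on the rest of [Z], [V'] is smaller than [a] by a fixed gap; outside
    [Z], [V'] is smaller than [V + c] by a fixed gap.  As [V] is a fixed point, the
    operator maps this combination to the same constant on [Z'].  That constant is
    positive, so the weak inequality is all that a supermartingale has to satisfy
    there. *)
Lemma gap_argmax_upper_le0 I g T V V' : monotone_op T -> affine_op T ->
  recursive_value I g T V ->
  recursive_value I (fun z => - g z) (dual_op T) (fun z => - V' z) ->
  forall z0, 0 < V' z0 - V z0 ->
  (forall z, V' z - V z <= V' z0 - V z0) -> V' z0 <= 0.
Proof.
move=> mT aT [Vg TV _ _] [V'g TV' V'min V'approx] z0.
set c := V' z0 - V z0 => c0 cmax; rewrite leNgt; apply/negP => V'0.
have {}TV' z : I z -> T V' z = V' z.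
  move=> /TV'; rewrite /dual_op => /oppr_inj.
  by under eq_fun do rewrite opprK.
have {}V'g z : ~~ I z -> V' z = g z by move=> /V'g /oppr_inj.
pose Z z := V' z - V z == c.
have [z1 Zz1 z1max] := @arg_maxP _ R S z0 Z V' (eqxx _).
set a := V' z1 in z1max.
have a0 : 0 < a by apply: lt_le_trans V'0 _; apply: z1max; exact: eqxx.
have ZI z : Z z -> I z.
  by move=> /eqP Zz; apply: contraTT c0 => nIz; rewrite -Zz V'g// Vg// subrr ltxx.
pose Z' z := Z z && (V' z == a).
have [k k0 kP] : exists2 k, 0 < k & forall y, Z y && ~~ Z' y -> k <= a - V' y.
  apply: pos_lower_bound => y /andP[Zy]; rewrite /Z' Zy/= => ya.
  by rewrite subr_gt0 lt_neqAle ya; exact: z1max.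
have [e e0 eP] : exists2 e, 0 < e & forall y, ~~ Z y -> e <= c - (V' y - V y).
  by apply: pos_lower_bound => y Zy; rewrite subr_gt0 lt_neqAle Zy cmax.
pose M : R := \sum_y `|V' y - a|.
have M0 : 0 <= M by apply: sumr_ge0.
have MP y : V' y - a <= M.
  apply: le_trans (ler_norm _) _.
  by rewrite /M (bigD1 y)//= lerDl; apply: sumr_ge0.
pose th := e / (2 * (e + M)).
have eM0 : 0 < e + M by lra.
have thE : th * (e + M) = e / 2 by rewrite /th; field; lra.
have th0 : 0 < th by rewrite /th divr_gt0// mulr_gt0.
have th1 : th <= 1 by rewrite /th ler_pdivrMr; lra.
pose n := Num.min (th * k) (Num.min (e / 2) a).
have n0 : 0 < n by rewrite /n !lt_min a0 mulr_gt0//= andbT; lra.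
have nk : n <= th * k by rewrite /n ge_min lexx.
have ne : n <= e / 2 by rewrite /n !ge_min lexx orbT.
have na : n <= a by rewrite /n !ge_min lexx !orbT.
have n20 : 0 < n / 2 by lra.
have [W CW WV'] := V'approx _ n20.
pose U y := - W y.
have UV' y : U y <= V' y + n / 2 by have := WV' y; rewrite /U; lra.
have V'U y : V' y <= U y by have := V'min W CW y; rewrite /U; lra.
pose U' y := if Z' y then a - n / 2 else U y.
(* the convex combination of the lower value and of the constant [a] that
   dominates the lowered upper value everywhere *)
have U'le y : U' y <= (1 - th) * V y + ((1 - th) * c + th * a - n / 2).
  rewrite /U'; case: ifPn => [/andP[/eqP Zy /eqP ya]|nZ'].
    have -> : V y = a - c by lra.
    by rewrite le_eqVlt; apply/orP; left; apply/eqP; ring.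
  have := UV' y; case: (boolP (Z y)) => Zy.
    have := kP y; rewrite Zy => /(_ nZ') ky.
    move: Zy => /eqP Zy.
    have -> : V y = V' y - c by lra.
    have : th * k <= th * (a - V' y) by rewrite ler_wpM2l// ltW.
    by move=> *; lra.
  have := eP y Zy => ey.
  have h1 : (1 - th) * e <= (1 - th) * (c - (V' y - V y)).
    by rewrite ler_wpM2l// subr_ge0.
  have h2 : th * (V' y - a) <= th * M by rewrite ler_wpM2l// ltW.
  by move=> *; lra.
have TU' z : Z' z -> T U' z <= a - n / 2.
  move=> /andP[Zz /eqP za]; apply: (le_trans (mT _ _ U'le z)).
  have th10 : 0 <= 1 - th by rewrite subr_ge0.
  rewrite aT// TV; last exact: ZI.
  move: Zz => /eqP Zz.
  have -> : V z = a - c by lra.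
  by rewrite le_eqVlt; apply/orP; left; apply/eqP; ring.
suff /V'min/(_ z1) : submartingale I (fun z => - g z) (dual_op T) (fun y => - U' y).
  by rewrite /U' /Z' Zz1 eqxx/= -/a; lra.
have [Wg WT] := CW.
have NU' : (fun y => - - U' y) = U' by apply/funext => y; rewrite opprK.
have NU : (fun y => - W y) = U by [].
split=> z Iz.
  rewrite /U'; case: ifPn => [/andP[/ZI]|_]; first by rewrite (negbTE Iz).
  by rewrite /U opprK Wg.
rewrite /dual_op NU' /U'; case: ifPn => Z'z.
  by have := TU' z Z'z; rewrite -/(U'); split => [|h]; lra.
have U'U y : U' y <= U y.
  rewrite /U'; case: ifPn => // /andP[_ /eqP ya].
  by apply: le_trans (V'U y); rewrite ya; lra.
have := mT _ _ U'U z; have [] := WT z Iz.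
rewrite /dual_op NU /U opprK => h1 h2 h3; split; first lra.
by move=> /h2 h4; lra.
Qed.

(** A positive gap between the two values is impossible: at a maximal gap the upper
    value would be nonpositive and, by duality, the lower one nonnegative. *)
Theorem recursive_game_determined I g T (e : R) :
  monotone_op T -> affine_op T -> 0 < e ->
  exists W W' : S -> R, [/\ submartingale I g T W,
    submartingale I (fun z => - g z) (dual_op T) (fun z => - W' z) &
    forall z, W' z <= W z + e].
Proof.
move=> mT aT e0.
have [V vV] := @recursive_value_exists I g T mT aT.
have mT' := dual_monotone mT; have aT' := dual_affine aT.
have [N vN] := @recursive_value_exists I (fun z => - g z) (dual_op T) mT' aT'.
pose V' z := - N z.
have vV' : recursive_value I (fun z => - g z) (dual_op T) (fun z => - V' z).
  by rewrite (_ : (fun z => - V' z) = N)//; apply/funext => z; rewrite /V' opprK.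
have V'V z : V' z <= V z.
  rewrite -subr_le0.
  have [z0 _ z0max] := @arg_maxP _ R S z xpredT (fun z => V' z - V z) isT.
  apply: (le_trans (z0max z isT)); rewrite leNgt; apply/negP => c0.
  have h1 : V' z0 <= 0.
    by apply: (@gap_argmax_upper_le0 I g T V V') => // y; exact: z0max.
  (* the same lemma for the game with the players exchanged *)
  suff h2 : - V z0 <= 0 by lra.
  apply: (@gap_argmax_upper_le0 I (fun z => - g z) (dual_op T)
            (fun z => - V' z) (fun z => - V z)) => //.
  - rewrite (_ : (fun z => - - g z) = g); last by apply/funext => y; rewrite opprK.
    rewrite (_ : dual_op (dual_op T) = T); last first.
      apply/funext => W; apply/funext => y; rewrite /dual_op opprK.
      by under eq_fun do rewrite opprK.
    by rewrite (_ : (fun z => - - V z) = V)//; apply/funext => y; rewrite opprK.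
  - by rewrite opprK addrC.
  - by move=> y; rewrite !opprK ![- V _ + _]addrC; exact: z0max.
have e2 : 0 < e / 2 by lra.
have [_ _ _ /(_ _ e2)[W CW WV]] := vV.
have [_ _ _ /(_ _ e2)[W' CW' W'V]] := vN.
exists W, (fun z => - W' z); split=> //.
  by rewrite (_ : (fun z => - - W' z) = W')//; apply/funext => y; rewrite opprK.
by move=> z; have := WV z; have := W'V z; have := V'V z; rewrite /V'; lra.
Qed.

End RecursiveGame.

(** * Finite stochastic games and potentials *)

Section FiniteGame.
Context {R : realType} {S : finType}.

(** The game stops on leaving [inner] and then pays [stop], without discount; a
    visit to [z] lasts [dur z] and is charged at the rate [rate z]. *)
Record fgame := FGame {
  inner : pred S;
  kernel : S -> S -> R -> R -> R;
  rate : S -> R -> R -> R;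
  stop : S -> R;
  dur : S -> R;
  disc : R;
  acts1 : set R;
  acts2 : set R
}.
Implicit Types (G : fgame) (z y : S) (W : S -> R).

(** The one-shot game at [z] with continuation [W]; [c] is the weight of the running
    cost, that is, the discount factor at the current time multiplied by the
    duration of the visit. *)
Definition stage G z (c : R) W (r1 r2 : R) : R :=
  c * rate G z r1 r2 + \sum_y kernel G z y r1 r2 * W y.

Record regular G : Prop := Regular {
  acts1_nonempty : acts1 G !=set0;
  acts2_nonempty : acts2 G !=set0;
  kernel_ge0 : forall z y r1 r2, inner G z -> acts1 G r1 -> acts2 G r2 ->
    0 <= kernel G z y r1 r2;
  kernel_sum1 : forall z r1 r2, inner G z -> acts1 G r1 -> acts2 G r2 ->
    \sum_y kernel G z y r1 r2 = 1;
  rate_bounded : exists2 M, 0 <= M & forall z r1 r2,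
    inner G z -> acts1 G r1 -> acts2 G r2 -> `|rate G z r1 r2| <= M;
  dur_gt0 : forall z, 0 < dur G z;
  disc_gt0 : 0 < disc G;
  stage_saddle : forall z c W, inner G z -> 0 <= c ->
    saddle_point (acts1 G) (acts2 G) (stage G z c W)
}.

(** Exchanging the players and negating the costs turns every statement on what the
    maximizer can secure into one on the minimizer. *)
Definition dual G : fgame :=
  FGame (inner G) (fun z y r2 r1 => kernel G z y r1 r2)
    (fun z r2 r1 => - rate G z r1 r2) (fun z => - stop G z) (dur G) (disc G)
    (acts2 G) (acts1 G).

Lemma stage_dual G z c W r1 r2 :
  stage (dual G) z c (fun y => - W y) r2 r1 = - stage G z c W r1 r2.
Proof.
rewrite /stage /= mulrN opprD -sumrN; congr (_ + _).
by apply: eq_bigr => y _; rewrite mulrN.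
Qed.

Lemma fun_opprK W : (fun y => - - W y) = W.
Proof. by apply/funext => y; rewrite opprK. Qed.

Lemma regular_dual G : regular G -> regular (dual G).
Proof.
case=> U1 U2 p0 p1 [M M0 KM] d0 b0 sad; split=> //=.
- by move=> z y r1 r2 Iz Ur1 Ur2; exact: p0.
- by move=> z r1 r2 Iz Ur1 Ur2; exact: p1.
- by exists M => // z r1 r2 Iz Ur1 Ur2; rewrite normrN; exact: KM.
- move=> z c W Iz c0; rewrite -(fun_opprK W).
  have [r1 [r2 [Ur1 Ur2 h1 h2]]] := sad z c (fun y => - W y) Iz c0.
  exists r2, r1; split=> //.
    by move=> s Us; rewrite !stage_dual lerN2; exact: h2.
  by move=> s Us; rewrite !stage_dual lerN2; exact: h1.
Qed.

(** A saddle point if there is one; the default pair keeps the actions admissible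
    at the stopped states. *)
Definition optimal G z c W : R * R :=
  let r1 := xget 0 (acts1 G) in let r2 := xget 0 (acts2 G) in
  xget (r1, r2) [set r | [/\ acts1 G r.1, acts2 G r.2,
    forall s, acts1 G s -> stage G z c W r.1 r.2 <= stage G z c W s r.2 &
    forall s, acts2 G s -> stage G z c W r.1 s <= stage G z c W r.1 r.2]].

Definition value G z c W : R :=
  stage G z c W (optimal G z c W).1 (optimal G z c W).2.

Lemma optimal_acts G z c W : regular G ->
  acts1 G (optimal G z c W).1 /\ acts2 G (optimal G z c W).2.
Proof.
case=> [[r1 Ur1] [r2 Ur2]] _ _ _ _ _ _; rewrite /optimal.
by case: xgetP => [r _ []//|_] /=; split; [exact: (xgetI 0 Ur1)|exact: (xgetI 0 Ur2)].
Qed.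

Lemma optimalP G z c W : regular G -> inner G z -> 0 <= c ->
  (forall s, acts1 G s -> value G z c W <= stage G z c W s (optimal G z c W).2)
  /\ (forall s, acts2 G s ->
        stage G z c W (optimal G z c W).1 s <= value G z c W).
Proof.
move=> [_ _ _ _ _ _ _ sad] Iz c0; rewrite /value /optimal.
case: xgetP => [r _ []//|]; have [r1 [r2 [Ur1 Ur2 h1 h2]]] := sad z c W Iz c0.
by move=> /(_ (r1, r2)) []; split.
Qed.

(** Monotonicity, homogeneity and invariance under translations of the value at
    once: the minimizer plays its optimal action of the second game against the
    optimal action of the maximizer in the first. *)
Lemma value_le G z c W c' W' (s d : R) : regular G -> inner G z ->
  0 <= c -> 0 <= c' -> 0 <= s ->
  (forall r1 r2, acts1 G r1 -> acts2 G r2 ->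
    stage G z c W r1 r2 <= s * stage G z c' W' r1 r2 + d) ->
  value G z c W <= s * value G z c' W' + d.
Proof.
move=> rG Iz c0 c'0 s0 h.
have [h1 _] := optimalP W rG Iz c0; have [_ h2] := optimalP W' rG Iz c'0.
have [_ a2] := optimal_acts z c W rG; have [a1 _] := optimal_acts z c' W' rG.
apply: (le_trans (h1 _ a1)); apply: (le_trans (h _ _ a1 a2)).
by rewrite lerD2r ler_wpM2l// h2.
Qed.

Lemma value_ge G z c W c' W' (s d : R) : regular G -> inner G z ->
  0 <= c -> 0 <= c' -> 0 <= s ->
  (forall r1 r2, acts1 G r1 -> acts2 G r2 ->
    s * stage G z c' W' r1 r2 + d <= stage G z c W r1 r2) ->
  s * value G z c' W' + d <= value G z c W.
Proof.
move=> rG Iz c0 c'0 s0 h.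
have [h1 _] := optimalP W' rG Iz c'0; have [_ h2] := optimalP W rG Iz c0.
have [_ a2] := optimal_acts z c' W' rG; have [a1 _] := optimal_acts z c W rG.
apply: le_trans (h2 _ a2); apply: le_trans (h _ _ a1 a2).
by rewrite lerD2r ler_wpM2l// h1.
Qed.

Lemma value_dual G z c W : regular G -> inner G z -> 0 <= c ->
  value (dual G) z c (fun y => - W y) = - value G z c W.
Proof.
move=> rG Iz c0; have rG' := regular_dual rG.
have [h1 h2] := optimalP W rG Iz c0.
have [h3 h4] := @optimalP (dual G) z c (fun y => - W y) rG' Iz c0.
have [a1 a2] := optimal_acts z c W rG.
have [b2 b1] := optimal_acts z c (fun y => - W y) rG'.
apply/le_anti/andP; split.
  by apply: (le_trans (h3 _ a2)); rewrite stage_dual lerN2; exact: h1.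
by apply: le_trans (h4 _ a1); rewrite stage_dual lerN2; exact: h2.
Qed.

Lemma kernel_monotone G z W W' r1 r2 : regular G -> inner G z ->
  acts1 G r1 -> acts2 G r2 -> (forall y, W y <= W' y) ->
  \sum_y kernel G z y r1 r2 * W y <= \sum_y kernel G z y r1 r2 * W' y.
Proof.
move=> rG Iz U1 U2 WW'; apply: ler_sum => y _; apply: ler_wpM2l => //.
exact: kernel_ge0.
Qed.

Lemma kernel_shift G z W (d : R) r1 r2 : regular G -> inner G z ->
  acts1 G r1 -> acts2 G r2 ->
  \sum_y kernel G z y r1 r2 * (W y + d) =
  \sum_y kernel G z y r1 r2 * W y + d.
Proof.
move=> rG Iz U1 U2; under eq_bigr do rewrite mulrDr.
by rewrite big_split/= -mulr_suml kernel_sum1// mul1r.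
Qed.

Definition value_op G W z : R := if inner G z then value G z 0 W else W z.

Lemma value_op_monotone G : regular G -> monotone_op (value_op G).
Proof.
move=> rG W W' WW' z; rewrite /value_op; case: ifPn => // Iz.
rewrite -[leRHS]addr0 -[leRHS in _ <= leRHS + _]mul1r.
apply: value_le => // r1 r2 U1 U2; rewrite mul1r addr0 /stage !mul0r !add0r.
exact: kernel_monotone.
Qed.

Lemma value_op_affine G : regular G -> affine_op (value_op G).
Proof.
move=> rG s W c z s0; rewrite /value_op; case: ifPn => // Iz.
have stageE r1 r2 : acts1 G r1 -> acts2 G r2 ->
    stage G z 0 (fun y => s * W y + c) r1 r2 = s * stage G z 0 W r1 r2 + c.
  move=> U1 U2; rewrite /stage !mul0r !add0r kernel_shift//; congr (_ + _).
  by rewrite mulr_sumr; apply: eq_bigr => y _; rewrite mulrCA.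
apply/le_anti/andP; split.
  by apply: value_le => // r1 r2 U1 U2; rewrite stageE.
by apply: value_ge => // r1 r2 U1 U2; rewrite stageE.
Qed.

Lemma value_op_dual G : regular G -> value_op (dual G) = dual_op (value_op G).
Proof.
move=> rG; apply/funext => W; apply/funext => z; rewrite /dual_op /value_op /=.
case: ifPn => [Iz|_]; last by rewrite opprK.
by rewrite -value_dual// fun_opprK.
Qed.

Definition discount G (t : R) : R := expR (- disc G * t).

Lemma discountD G s t : discount G (s + t) = discount G s * discount G t.
Proof. by rewrite /discount mulrDr expRD. Qed.

Lemma discount_gt0 G t : 0 < discount G t.
Proof. exact: expR_gt0. Qed.

Lemma discount_le1 G t : regular G -> 0 <= t -> discount G t <= 1.
Proof.
move=> rG t0; rewrite /discount -expR0 ler_expR mulNr oppr_le0.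
by rewrite mulr_ge0// ltW// disc_gt0.
Qed.

Lemma discount_lt1 G t : regular G -> 0 < t -> discount G t < 1.
Proof.
move=> rG t0; rewrite /discount -expR0 ltr_expR mulNr oppr_lt0.
by rewrite mulr_gt0// disc_gt0.
Qed.

(** With such a [C], the running cost accumulated from time [t] on is at most
    [C * discount t] in absolute value, by telescoping. *)
Definition tail_bound G (C : R) : Prop := 0 <= C /\
  forall z r1 r2, inner G z -> acts1 G r1 -> acts2 G r2 ->
    dur G z * `|rate G z r1 r2| <= C * (1 - discount G (dur G z)).

Lemma tail_bound_dual G C : tail_bound G C -> tail_bound (dual G) C.
Proof. by move=> [C0 h]; split=> // z r1 r2 Iz U1 U2; rewrite /= normrN h. Qed.

Lemma tail_bound_exists G : regular G -> exists C, tail_bound G C.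
Proof.
move=> rG; have [M M0 KM] := rate_bounded rG.
have d1 z : 0 < 1 - discount G (dur G z).
  by rewrite subr_gt0 discount_lt1// dur_gt0.
pose c z := dur G z * M / (1 - discount G (dur G z)).
have c0 z : 0 <= c z.
  by apply: divr_ge0; [apply: mulr_ge0 => //|]; apply: ltW; rewrite ?dur_gt0.
exists (\sum_z c z); split; first exact: sumr_ge0.
move=> z r1 r2 Iz U1 U2.
apply: (@le_trans _ _ (c z * (1 - discount G (dur G z)))).
  rewrite /c divfK ?gt_eqF//; apply: ler_wpM2l; first exact/ltW/dur_gt0.
  exact: KM.
apply: ler_wpM2r; first exact/ltW.
by rewrite (bigD1 z)//= lerDl sumr_ge0.
Qed.

(** Dynamic programming over [j] steps, [t] being the elapsed time, with [W]
    corrected by the worst case [c * discount t] of the later running costs as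
    terminal value.  The time is an argument because the terminal payoff is not
    discounted, so that the continuation value is not proportional to the
    discount factor. *)
Fixpoint planned G W (c : R) (j : nat) (t : R) z : R :=
  if inner G z then
    if j is j'.+1 then
      value G z (discount G t * dur G z) (planned G W c j' (t + dur G z))
    else W z + c * discount G t
  else stop G z.

Lemma planned_stop G W c j t z : ~~ inner G z -> planned G W c j t z = stop G z.
Proof. by move=> nIz; case: j => [|j] /=; rewrite (negbTE nIz). Qed.

Lemma weight_ge0 G t z : regular G -> 0 <= discount G t * dur G z.
Proof.
by move=> rG; apply: mulr_ge0; apply/ltW; [exact: discount_gt0|exact: dur_gt0].
Qed.

Lemma planned_dual G W c j t z : regular G ->
  planned (dual G) (fun y => - W y) (- c) j t z = - planned G W c j t z.
Proof.
move=> rG; elim: j t z => [|j IH] t z /=; case: ifPn => // Iz.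
  by rewrite mulNr opprD.
rewrite -value_dual//; last exact: weight_ge0.
by congr value; apply/funext => y; rewrite IH.
Qed.

Lemma stage_bounded G z c W (M : R) : regular G -> inner G z -> 0 <= c ->
  (forall y, `|W y| <= M) -> forall r1 r2, acts1 G r1 -> acts2 G r2 ->
  `|stage G z c W r1 r2| <= c * `|rate G z r1 r2| + M.
Proof.
move=> rG Iz c0 WM r1 r2 U1 U2; apply: (le_trans (ler_normD _ _)).
rewrite normrM (ger0_norm c0) lerD2l.
apply: (le_trans (ler_norm_sum _ _ _)).
rewrite -[leRHS]mul1r -(kernel_sum1 rG Iz U1 U2) mulr_suml.
apply: ler_sum => y _; rewrite normrM ger0_norm; last exact: kernel_ge0.
by apply: ler_wpM2l => //; exact: kernel_ge0.
Qed.

Lemma planned_bounded G W c N : regular G ->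
  exists B, forall j t z, (j <= N)%N -> 0 <= t -> `|planned G W c j t z| <= B.
Proof.
move=> rG; have [M M0 KM] := rate_bounded rG.
pose B0 : R := \sum_z (`|W z| + `|c| + `|stop G z|).
pose D : R := \sum_z dur G z.
have D0 : 0 <= D by apply: sumr_ge0 => z _; exact/ltW/dur_gt0.
have dD z : dur G z <= D.
  by rewrite /D (bigD1 z)//= lerDl sumr_ge0// => y _; exact/ltW/dur_gt0.
have zB0 z : `|W z| + `|c| + `|stop G z| <= B0.
  by rewrite /B0 (bigD1 z)//= lerDl sumr_ge0// => y _; rewrite !addr_ge0.
exists (B0 + N%:R * (D * M)) => j t z jN t0.
have : `|planned G W c j t z| <= B0 + j%:R * (D * M).
  elim: j t z {jN} t0 => [|j IH] t z t0 /=; case: ifPn => Iz.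
  - rewrite mul0r addr0; apply: le_trans (zB0 z).
    apply: (@le_trans _ _ (`|W z| + `|c|)); last by rewrite lerDl.
    apply: (le_trans (ler_normD _ _)); rewrite lerD2l normrM -[leRHS]mulr1.
    apply: ler_wpM2l => //; rewrite gtr0_norm ?discount_gt0//.
    exact: discount_le1.
  - rewrite mul0r addr0; apply: le_trans (zB0 z).
    by rewrite lerDr addr_ge0.
  - have [a1 a2] := optimal_acts z (discount G t * dur G z)
      (planned G W c j (t + dur G z)) rG.
    have tz0 : 0 <= t + dur G z by apply: addr_ge0 => //; exact/ltW/dur_gt0.
    apply: (le_trans (stage_bounded rG Iz (weight_ge0 t z rG)
      (fun y => IH _ y tz0) a1 a2)).
    rewrite addrC -addrA lerD2l -nat1r mulrDl mul1r addrC lerD2r.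
    apply: ler_pM => //; first exact: weight_ge0.
    + rewrite -[leRHS]mul1r; apply: ler_pM => //.
      * exact/ltW/discount_gt0.
      * exact/ltW/dur_gt0.
      * exact: discount_le1.
    + exact: KM.
  - apply: (@le_trans _ _ B0).
      by apply: le_trans (zB0 z); rewrite lerDr addr_ge0.
    by rewrite lerDl mulr_ge0// mulr_ge0.
move=> /le_trans; apply; rewrite lerD2l; apply: ler_wpM2r; first exact: mulr_ge0.
by rewrite ler_nat.
Qed.

(** The two terminal values differ by the corrections for the remaining running
    costs, discounted over at least [j * d] units of time. *)
Lemma planned_close G W W' (C e d : R) j t z : regular G ->
  0 <= C -> 0 <= e -> (forall y, d <= dur G y) ->
  (forall y, W' y <= W y + e) ->
  planned G W' C j t z <=
  planned G W (- C) j t z + (e + 2 * C * discount G (t + j%:R * d)).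
Proof.
move=> rG C0 e0 dd W'W.
have r0 s : 0 <= e + 2 * C * discount G s.
  by rewrite addr_ge0// mulr_ge0// ?mulr_ge0// ltW// discount_gt0.
elim: j t z => [|j IH] t z /=; case: ifPn => Iz; rewrite ?lerDl//.
  by rewrite mul0r addr0; have := W'W z; lra.
rewrite -[X in _ <= X + _]mul1r; have w0 := weight_ge0 t z rG.
apply: value_le => // r1 r2 U1 U2; rewrite mul1r /stage -addrA lerD2l.
rewrite -kernel_shift//; apply: kernel_monotone => // y.
apply: (le_trans (IH _ _)); rewrite lerD2l lerD2l ler_wpM2l ?mulr_ge0//.
rewrite ler_expR !mulNr lerN2 ler_wpM2l ?(ltW (disc_gt0 rG))//.
by rewrite -nat1r mulrDl mul1r; have := dd z; lra.
Qed.

(** The expected increase of accumulated cost plus [F] over one step. *)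
Definition drift_gain G (F : nat -> R -> S -> R) k t z r1 r2 : R :=
  stage G z (discount G t * dur G z) (F k.+1 (t + dur G z)) r1 r2 - F k t z.

(** A certificate that the maximizer, by playing [phi] at step [k] and time [t], can
    secure [F 0 0 z] from [z].  By [potential_drift] the accumulated cost plus [F]
    is a submartingale; [potential_final] makes the contribution of [F] on the
    event of survival vanish in the limit, being dominated by the increments of a
    bounded monotone sequence. *)
Record potential G (F : nat -> R -> S -> R) (phi : nat -> R -> S -> R) : Prop :=
  Potential {
  potential_act : forall k t z, acts2 G (phi k t z);
  potential_stop : forall k t z, ~~ inner G z -> F k t z = stop G z;
  potential_bounded : exists B, forall k t z, 0 <= t -> `|F k t z| <= B;
  potential_drift : forall k t z r1, 0 <= t -> inner G z -> acts1 G r1 ->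
    0 <= drift_gain G F k t z r1 (phi k t z);
  potential_final : exists N c, 0 <= c /\ forall k t z r1,
    (N <= k)%N -> 0 <= t -> inner G z -> acts1 G r1 ->
    F k t z <= c * drift_gain G F k t z r1 (phi k t z)
}.

(** Optimal play in the dynamic programming problem during [N] steps, then optimal
    play against the submartingale [W].  In the second phase the drift of [W]
    absorbs its positive values, and the correction [C * discount t] absorbs the
    running costs. *)
Lemma potential_exists G W C N : regular G -> tail_bound G C ->
  submartingale (inner G) (stop G) (value_op G) W ->
  exists phi, potential G (fun k => planned G W (- C) (N - k)) phi.
Proof.
move=> rG [C0 CP] [Wstop WT].
set F := fun k : nat => planned G W (- C) (N - k).
pose phi k t z := if (k < N)%N
  then (optimal G z (discount G t * dur G z) (F k.+1 (t + dur G z))).2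
  else (optimal G z 0 W).2.
have gain_planned k t z r1 : (k < N)%N -> inner G z -> acts1 G r1 ->
    0 <= drift_gain G F k t z r1 (phi k t z).
  move=> kN Iz U1; rewrite subr_ge0 /phi kN {1}/F -(subnSK kN) /= Iz.
  have [h _] := optimalP (F k.+1 (t + dur G z)) rG Iz (weight_ge0 t z rG).
  exact: h.
have gain_final k t z r1 : (N <= k)%N -> inner G z -> acts1 G r1 ->
    value_op G W z - W z <= drift_gain G F k t z r1 (phi k t z).
  move=> Nk Iz U1; have N1 : (N <= k.+1)%N by apply: leqW.
  rewrite /phi ltnNge Nk /= /drift_gain /F; move: (Nk) (N1).
  rewrite -!subn_eq0 => /eqP -> /eqP ->; rewrite /= Iz.
  set r2 := (optimal G z 0 W).2.
  have U2 : acts2 G r2 by have [] := optimal_acts z 0 W rG.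
  have [/(_ r1 U1)] := optimalP W rG Iz (lexx 0).
  rewrite /value_op Iz /stage mul0r add0r -/r2 => h _.
  have := CP z r1 r2 Iz U1 U2.
  have : \sum_y kernel G z y r1 r2 * (W y + - C * discount G (t + dur G z)) <=
    \sum_y kernel G z y r1 r2 *
      (if inner G y then W y + - C * discount G (t + dur G z) else stop G y).
    apply: kernel_monotone => // y; case: ifPn => // nIy; rewrite Wstop//.
    by rewrite gerDl mulNr oppr_le0 mulr_ge0// ltW// discount_gt0.
  rewrite kernel_shift// discountD.
  have D0 := discount_gt0 G t; set Dt := discount G t in D0 *.
  set Ds := discount G (dur G z); set K := rate _ _ _ _ => h1 h2.
  have h3 : - (dur G z * `|K|) <= dur G z * K.
    rewrite -mulrN; apply: ler_wpM2l; first exact/ltW/dur_gt0.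
    by rewrite lerNl -normrN ler_norm.
  have h4 : Dt * (- (C * (1 - Ds))) <= Dt * (dur G z * K).
    by apply: ler_wpM2l; [exact: ltW|lra].
  by move: h1 h4; lra.
exists phi; split.
- move=> k t z; rewrite /phi; case: ifP => _.
    by have [] := optimal_acts z (discount G t * dur G z) (F k.+1 (t + dur G z)) rG.
  by have [] := optimal_acts z 0 W rG.
- by move=> k t z; exact: planned_stop.
- have [B BP] := planned_bounded W (- C) N rG; exists B => k t z.
  by apply: BP; exact: leq_subr.
- move=> k t z r1 _ Iz U1; have [kN|Nk] := ltnP k N; first exact: gain_planned.
  apply: le_trans (gain_final k t z r1 Nk Iz U1).
  by rewrite subr_ge0; have [] := WT z Iz.
(* [c] dominates every ratio of a positive value of [W] to its drift *)
pose c := \sum_(z | inner G z && (0 < W z)) W z / (value_op G W z - W z).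
have gap z : inner G z && (0 < W z) -> 0 < value_op G W z - W z.
  by move=> /andP[Iz Wz]; rewrite subr_gt0; have [_] := WT z Iz; exact.
have pos z : inner G z && (0 < W z) -> 0 <= W z / (value_op G W z - W z).
  by move=> /[dup] /gap /ltW h /andP[_ /ltW Wz]; exact: divr_ge0.
have c0 : 0 <= c by apply: sumr_ge0.
exists N, c; split=> // k t z r1 Nk t0 Iz U1.
apply: le_trans (ler_wpM2l c0 (gain_final k t z r1 Nk Iz U1)).
have FW : F k t z <= W z.
  move: Nk; rewrite /F -subn_eq0 => /eqP -> /=; rewrite Iz gerDl mulNr oppr_le0.
  by rewrite mulr_ge0// ltW// discount_gt0.
apply: (le_trans FW); have [Wz|Wz] := leP (W z) 0.
  apply: (le_trans Wz); apply: mulr_ge0 => //; rewrite subr_ge0.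
  by have [] := WT z Iz.
have Pz : inner G z && (0 < W z) by rewrite Iz.
rewrite -ler_pdivrMr ?gap// /c (bigD1 z)//= lerDl.
by apply: sumr_ge0 => y /andP[/pos].
Qed.

(** The recursive game without running costs is determined, and the running costs
    after a large number [N] of steps are negligible uniformly in the play, so the
    dynamic programming problems over [N] steps with terminal values from below
    and from above have almost the same value. *)
Theorem potentials_meet G (e : R) : regular G -> 0 < e ->
  exists F phi F' phi', [/\ potential G F phi, potential (dual G) F' phi' &
    forall z, - F' 0%N 0 z <= F 0%N 0 z + e].
Proof.
move=> rG e0; have [C CP] := tail_bound_exists rG; have [C0 _] := CP.
have e2 : 0 < e / 2 by lra.
have [W [W' [sW sW' W'W]]] := recursive_game_determined (inner G) (stop G)
  (value_op_monotone rG) (value_op_affine rG) e2.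
have [d d0 dP] := @pos_lower_bound R S xpredT (dur G) (fun z _ => dur_gt0 rG z).
have [N NP] : exists N, 2 * C * discount G (0 + N%:R * d) <= e / 2.
  have bd0 : 0 < disc G * d by apply: mulr_gt0 => //; exact: disc_gt0.
  pose x := 4 * C / e / (disc G * d).
  have x0 : 0 <= x.
    by apply: divr_ge0; [apply: divr_ge0; lra|exact: ltW].
  pose N := Num.bound x.
  have : x < N%:R by have := archi_boundP x0.
  rewrite /x ltr_pdivrMr// => NP.
  exists N; rewrite add0r /discount mulNr expRN.
  have E1 : 1 + N%:R * (disc G * d) <= expR (disc G * (N%:R * d)).
    by rewrite mulrCA expR_ge1Dx.
  rewrite ler_pdivrMr ?expR_gt0//.
  have : 4 * C / e <= expR (disc G * (N%:R * d)) by lra.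
  by rewrite ler_pdivrMr//; lra.
have [phi Fphi] := potential_exists N rG CP sW.
have rG' := regular_dual rG.
have sW'' : submartingale (inner (dual G)) (stop (dual G)) (value_op (dual G))
   (fun y => - W' y) by rewrite value_op_dual.
have [phi' Fphi'] := potential_exists N rG' (tail_bound_dual CP) sW''.
do 4 eexists; split; [exact: Fphi|exact: Fphi'|] => z /=.
rewrite planned_dual// opprK subn0.
apply: (le_trans (planned_close N 0 z rG C0 (ltW e2) (fun y => dP y isT) W'W)).
by rewrite lerD2l; lra.
Qed.

End FiniteGame.

(** * Costs along a path *)

Section Paths.
Context {R : realType} {S : finType}.
Variable G : @fgame R S.
Implicit Types (xi : nat -> S).

Definition time xi n : R := \sum_(k < n) dur G (xi k).

Definition alive xi n : bool := [forall k : 'I_n.+1, inner G (xi k)].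

Definition flow xi (v1 v2 : nat -> R) n : R :=
  discount G (time xi n) * rate G (xi n) (v1 n) (v2 n) * dur G (xi n).

(** The cost accumulated before step [n], and the terminal payoff as soon as the
    path is out. *)
Fixpoint cost_upto xi (v1 v2 : nat -> R) n : R :=
  if n is n'.+1 then
    cost_upto xi v1 v2 n' +
    if alive xi n' then
      flow xi v1 v2 n' + if inner G (xi n) then 0 else stop G (xi n)
    else 0
  else if inner G (xi 0%N) then 0 else stop G (xi 0%N).

Lemma timeS xi n : time xi n.+1 = time xi n + dur G (xi n).
Proof. by rewrite /time big_ord_recr. Qed.

Lemma aliveP xi n : reflect (forall k, (k <= n)%N -> inner G (xi k)) (alive xi n).
Proof.
apply: (iffP forallP) => [h k kn|h k]; last by apply: h; rewrite -ltnS.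
exact: (h (Ordinal (kn : (k < n.+1)%N))).
Qed.

Lemma aliveS xi n : alive xi n.+1 = alive xi n && inner G (xi n.+1).
Proof.
apply/aliveP/andP => [h|[/aliveP h hn] k].
  by split; [apply/aliveP => k kn; apply: h; exact: leqW|exact: h].
by rewrite leq_eqVlt => /predU1P[->//|]; exact: h.
Qed.

Lemma alive_inner xi n : alive xi n -> inner G (xi n).
Proof. by move=> /aliveP; apply. Qed.

Section Agree.
Variables (xi xi' : nat -> S) (v1 v1' v2 v2' : nat -> R) (n : nat).
Hypothesis xiE : forall k, (k <= n)%N -> xi k = xi' k.
Hypothesis v1E : forall k, (k <= n)%N -> v1 k = v1' k.
Hypothesis v2E : forall k, (k <= n)%N -> v2 k = v2' k.

Lemma time_agree k : (k <= n.+1)%N -> time xi k = time xi' k.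
Proof.
move=> kn; apply: eq_bigr => j _; rewrite xiE//.
by rewrite -ltnS; exact: leq_trans kn.
Qed.

Lemma alive_agree k : (k <= n)%N -> alive xi k = alive xi' k.
Proof.
move=> kn; apply: eq_forallb => j; rewrite xiE//.
by apply: leq_trans kn; rewrite -ltnS.
Qed.

Lemma flow_agree k : (k <= n)%N -> flow xi v1 v2 k = flow xi' v1' v2' k.
Proof.
by move=> kn; rewrite /flow time_agree ?(leqW kn)// xiE// v1E// v2E.
Qed.

Lemma cost_upto_agree k : (k <= n)%N ->
  cost_upto xi v1 v2 k = cost_upto xi' v1' v2' k.
Proof.
elim: k => [|k IH] kn /=; first by rewrite xiE.
by rewrite IH ?(ltnW kn)// alive_agree ?(ltnW kn)// flow_agree ?(ltnW kn)// xiE.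
Qed.

End Agree.

Hypothesis rG : regular G.

Lemma time_ge0 xi n : 0 <= time xi n.
Proof. by apply: sumr_ge0 => k _; apply/ltW/dur_gt0. Qed.

Section Bounds.
Variables (xi : nat -> S) (v1 v2 : nat -> R) (C : R).
Hypothesis CP : tail_bound G C.
Hypothesis v1P : forall n, acts1 G (v1 n).
Hypothesis v2P : forall n, acts2 G (v2 n).

Lemma flow_bounded n : inner G (xi n) ->
  `|flow xi v1 v2 n| <= C * (discount G (time xi n) - discount G (time xi n.+1)).
Proof.
move=> Iz; rewrite timeS discountD /flow.
have D0 := discount_gt0 G (time xi n); set D := discount _ _ in D0 *.
rewrite -mulrA normrM gtr0_norm// mulrC -[X in X * D]mulr1 normrM mulr1.
rewrite (gtr0_norm (dur_gt0 rG _)) [X in X * D]mulrC.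
have := CP.2 (xi n) (v1 n) (v2 n) Iz (v1P n) (v2P n) => h.
apply: (le_trans (ler_wpM2r (ltW D0) h)).
by rewrite le_eqVlt; apply/orP; left; apply/eqP; ring.
Qed.

Lemma discount_decreasing n :
  discount G (time xi n.+1) <= discount G (time xi n).
Proof.
rewrite timeS discountD -[leRHS]mulr1; apply: ler_wpM2l.
  exact/ltW/discount_gt0.
by apply: discount_le1 => //; exact/ltW/dur_gt0.
Qed.

(** The running costs telescope against the discount factor, and the terminal
    payoff is received at most once. *)
Lemma cost_upto_bounded n :
  `|cost_upto xi v1 v2 n| <= C + \sum_z `|stop G z|.
Proof.
have CB := CP.1; set B := \sum_z `|stop G z|.
have stopB z : `|stop G z| <= B by rewrite /B (bigD1 z)//= lerDl sumr_ge0.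
have B0 : 0 <= B by apply: sumr_ge0.
suff : `|cost_upto xi v1 v2 n| <=
    C * (1 - discount G (time xi n)) + if alive xi n then 0 else B.
  move=> /le_trans; apply; apply: lerD; last by case: ifP.
  rewrite -[leRHS]mulr1; apply: ler_wpM2l => //.
  by have := discount_gt0 G (time xi n); lra.
elim: n => [|n IH] /=.
  have -> : discount G (time xi 0) = 1.
    by rewrite /time big_ord0 /discount mulr0 expR0.
  rewrite subrr mulr0 add0r.
  have -> : alive xi 0 = inner G (xi 0%N).
    apply/aliveP/idP => [|h k]; first exact.
    by rewrite leqn0 => /eqP ->.
  by case: ifP => // _; rewrite normr0.
rewrite aliveS; have d := discount_decreasing n.
case: ifPn => [al|_] in IH *; last first.
  rewrite addr0 /=; apply: (le_trans IH); rewrite lerD2r.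
  by apply: ler_wpM2l => //; lra.
apply: (le_trans (ler_normD _ _)).
have h := flow_bounded (alive_inner al).
have h2 : `|flow xi v1 v2 n + (if inner G (xi n.+1) then 0 else stop G (xi n.+1))|
    <= C * (discount G (time xi n) - discount G (time xi n.+1)) +
       (if inner G (xi n.+1) then 0 else B).
  apply: (le_trans (ler_normD _ _)); apply: lerD => //.
  by case: ifP => // _; rewrite normr0.
by apply: (le_trans (lerD IH h2)); rewrite /=; lra.
Qed.

Lemma flow_summable : (forall n, inner G (xi n)) ->
  cvgn (series (flow xi v1 v2)).
Proof.
move=> Ixi; apply: normed_cvg.
apply: nondecreasing_is_cvgn.
  by apply: nondecreasing_series => n _ _ /=.
exists C => _ [n _ <-]; rewrite /series /=.
suff : \sum_(0 <= k < n) `|flow xi v1 v2 k| <= C * (1 - discount G (time xi n)).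
  move=> /le_trans; apply; rewrite -[leRHS]mulr1; apply: ler_wpM2l; first exact: CP.1.
  by have := discount_gt0 G (time xi n); lra.
elim: n => [|n IH].
  rewrite big_geq// /time big_ord0 /discount mulr0 expR0 subrr mulr0.
  by [].
rewrite big_nat_recr//=; apply: (le_trans (lerD IH (flow_bounded (Ixi n)))).
by lra.
Qed.

End Bounds.

Lemma cost_upto_inner xi v1 v2 n : (forall k, (k <= n)%N -> inner G (xi k)) ->
  cost_upto xi v1 v2 n = \sum_(k < n) flow xi v1 v2 k.
Proof.
elim: n => [|n IH] h /=; first by rewrite big_ord0 h.
rewrite big_ord_recr /= IH; last by move=> k kn; apply: h; exact: leqW.
rewrite h// ifT ?addr0//.
by apply/aliveP => k kn; apply: h; exact: leqW.
Qed.

Lemma cost_upto_exit xi v1 v2 N : (forall k, (k < N)%N -> inner G (xi k)) ->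
  ~~ inner G (xi N) -> forall n, (N <= n)%N ->
  cost_upto xi v1 v2 n = \sum_(k < N) flow xi v1 v2 k + stop G (xi N).
Proof.
move=> h hN; elim=> [|n IH].
  by rewrite leqn0 => /eqP N0; move: hN; rewrite N0 /= big_ord0 add0r => /negbTE ->.
rewrite leq_eqVlt => /predU1P[NE|Nn] /=.
  rewrite -NE; have al : alive xi n by apply/aliveP => k kn; apply: h; rewrite NE.
  rewrite al NE big_ord_recr/= cost_upto_inner; last by apply/aliveP.
  by rewrite -NE (negbTE hN) addrA.
rewrite IH// ifF ?addr0//; apply: contraNF hN => /aliveP; exact.
Qed.

End Paths.

(** * Conditional expectations along the chain *)

Section ControlledChain.
Context {R : realType} {S : finType} {d : measure_display}.
Context {T : measurableType d}.
Variables (P : probability T R) (X : nat -> T -> S).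

Definition cyl (n : nat) (s : nat -> S) : set T :=
  [set w | forall k, (k <= n)%N -> X k w = s k].

Definition past (n : nat) {V : Type} (f : T -> V) : Prop :=
  forall w w', (forall k, (k <= n)%N -> X k w = X k w') -> f w = f w'.

Hypothesis mX : forall n s, measurable [set w | X n w = s].

Lemma cylS n s : cyl n.+1 s = cyl n s `&` [set w | X n.+1 w = s n.+1].
Proof.
apply/seteqP; split=> [w h|w [h hn] k].
  by split=> [k kn|]; apply: h => //; exact: leqW.
by rewrite leq_eqVlt => /predU1P[->//|]; exact: h.
Qed.

Lemma measurable_cyl n s : measurable (cyl n s).
Proof.
elim: n => [|n IH]; last by rewrite cylS; exact: measurableI.
rewrite (_ : cyl 0 s = [set w | X 0%N w = s 0%N])//.
apply/seteqP; split=> [w|w h k]; first exact.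
by rewrite leqn0 => /eqP ->.
Qed.

(** There are finitely many cylinders of length [n], and a function of the past is
    constant on each of them. *)
Lemma past_decomp n (f : T -> R) : past n f ->
  exists c : {ffun 'I_n.+1 -> S} -> R, forall w, f w =
    \sum_(s : {ffun 'I_n.+1 -> S}) c s * \1_(cyl n (fun k => s (inord k))) w.
Proof.
move=> pf.
have cE (s : {ffun 'I_n.+1 -> S}) : exists a : R,
    forall w, cyl n (fun k => s (inord k)) w -> f w = a.
  have [[w0 Cw0]|nC] := pselect (exists w, cyl n (fun k => s (inord k)) w).
    by exists (f w0) => w Cw; apply: pf => k kn; rewrite Cw// Cw0.
  by exists 0 => w Cw; exfalso; apply: nC; exists w.
have [c cP] := choice cE.
exists c => w; pose sw := [ffun k : 'I_n.+1 => X k w].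
have Cw : cyl n (fun k => sw (inord k)) w.
  by move=> k kn /=; rewrite ffunE inordK// ltnS.
rewrite (bigD1 sw)//= big1 ?addr0; last first.
  move=> s ssw; rewrite indicE memNset ?mulr0// => Csw.
  move/eqP: ssw; apply; apply/ffunP => k; rewrite ffunE.
  have kn : (k <= n)%N by rewrite -ltnS.
  by rewrite (Csw _ kn) inord_val.
by rewrite indicE mem_set// mulr1; exact: cP.
Qed.

Lemma integrable_indic_cyl n s (c : R) :
  P.-integrable setT (EFin \o (fun w => c * \1_(cyl n s) w)).
Proof.
rewrite (_ : _ \o _ = fun w => (c%:E * (\1_(cyl n s) w)%:E)%E)//.
apply: (@integrableZl _ _ _ P setT measurableT c (fun w => (\1_(cyl n s) w)%:E)).
by apply: integrable_indic; exact: measurable_cyl.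
Qed.

Lemma past_integrable n f : past n f -> P.-integrable setT (EFin \o f).
Proof.
move=> /past_decomp[c cE].
rewrite (_ : _ \o _ = fun w => (\sum_(s : {ffun 'I_n.+1 -> S})
    (c s * \1_(cyl n (fun k => s (inord k))) w)%:E)%E); last first.
  by apply/funext => w /=; rewrite cE sumEFin.
by apply: integrable_sum => [|s _]; [exact: measurableT|exact: integrable_indic_cyl].
Qed.

Lemma Rintegral_sum (I : Type) (r : seq I) (f : I -> T -> R) :
  (forall i, P.-integrable setT (EFin \o f i)) ->
  \int[P]_w (\sum_(i <- r) f i w) = \sum_(i <- r) \int[P]_w (f i w).
Proof.
move=> fi; rewrite /Rintegral; under eq_integral do rewrite -sumEFin.
rewrite integral_sum// -sum_fine//.
by move=> i _; apply: integrable_fin_num => //; exact: fi.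
Qed.

Section OneStep.
Variables (n : nat) (q : T -> S -> R).
Hypothesis pq : forall y, past n (q ^~ y).
Hypothesis law : forall s, P (cyl n.+1 s) =
  (\int[P]_(w in cyl n s) (q w (s n.+1))%:E)%E.

(** The conditional law of the next state, transferred from cylinders to functions
    of the past by linearity. *)
Lemma expect_next_state f y : past n f ->
  \int[P]_w (f w * (X n.+1 w == y)%:R) = \int[P]_w (f w * q w y).
Proof.
move=> pf; have [c cE] := past_decomp pf.
pose cs (s : {ffun 'I_n.+1 -> S}) := cyl n (fun k => s (inord k)).
have -> : (fun w => f w * (X n.+1 w == y)%:R) =
    fun w => \sum_s c s * (\1_(cs s) w * (X n.+1 w == y)%:R).
  by apply/funext => w; rewrite cE mulr_suml; apply: eq_bigr => s _; rewrite mulrA.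
have -> : (fun w => f w * q w y) = fun w => \sum_s c s * (\1_(cs s) w * q w y).
  by apply/funext => w; rewrite cE mulr_suml; apply: eq_bigr => s _; rewrite mulrA.
have pind s : past n (\1_(cs s) : T -> R).
  move=> w w' ww'; rewrite !indicE; congr (_ %:R); congr nat_of_bool.
  apply/idP/idP; rewrite !inE => h k kn; first by rewrite -ww'// h.
  by rewrite ww'// h.
have i1 s : P.-integrable setT (EFin \o (fun w => \1_(cs s) w * (X n.+1 w == y)%:R)).
  apply: (@past_integrable n.+1) => w w' ww'; rewrite ww'//; congr (_ * _).
  by apply: pind => k kn; apply: ww'; exact: leqW.
have i2 s : P.-integrable setT (EFin \o (fun w => \1_(cs s) w * q w y)).
  by apply: (@past_integrable n) => w w' ww'; rewrite (pq y ww') (pind s _ _ ww').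
have iZ (g : T -> R) (r : R) : P.-integrable setT (EFin \o g) ->
    P.-integrable setT (EFin \o (fun w => r * g w)).
  by move=> ig; exact: (integrableZl measurableT r ig).
rewrite !Rintegral_sum; [|by move=> s; apply/iZ/i2|by move=> s; apply/iZ/i1].
apply: eq_bigr => s _; rewrite !RintegralZl//; congr (_ * _).
pose s' k := if (k <= n)%N then s (inord k) else y.
have cs' : cs s = cyl n s'.
  by apply/seteqP; split=> w h k kn; have := h k kn; rewrite /s' kn.
transitivity (fine (P (cyl n.+1 s'))).
  rewrite /Rintegral; congr fine.
  rewrite -(setIT (cyl _ _)) -integral_indic//; last exact: measurable_cyl.
  apply: eq_integral => w _; congr EFin; rewrite !indicE -natrM mulnb.
  congr (_ %:R); congr nat_of_bool; rewrite cylS -cs'.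
  apply/andP/idP => [[]|]; rewrite !inE.
    by move=> h /eqP h'; split=> //=; rewrite h' /s' ltnn.
  by move=> [h /= h']; split; rewrite ?inE// h' /s' ltnn.
rewrite law /s' ltnn -/s' -cs' [RHS]/Rintegral; congr fine; rewrite [LHS]integral_mkcond.
apply: eq_integral => w _; rewrite /patch indicE.
by case: ifPn => _; rewrite ?mul1r ?mul0r.
Qed.

Lemma expect_next (f : T -> S -> R) : (forall y, past n (f ^~ y)) ->
  \int[P]_w (f w (X n.+1 w)) = \int[P]_w (\sum_y f w y * q w y).
Proof.
move=> pf.
have -> : (fun w => f w (X n.+1 w)) =
    fun w => \sum_y f w y * (X n.+1 w == y)%:R.
  apply/funext => w; rewrite (bigD1 (X n.+1 w))//= eqxx mulr1 big1 ?addr0//.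
  by move=> y yX; rewrite eq_sym (negbTE yX) mulr0.
rewrite !Rintegral_sum.
- by apply: eq_bigr => y _; exact: expect_next_state.
- by move=> y; apply: (@past_integrable n) => w w' ww'; rewrite (pf y _ _ ww') (pq y ww').
- move=> y; apply: (@past_integrable n.+1) => w w' ww'; rewrite ww'//; congr (_ * _).
  by apply: pf => k kn; apply: ww'; exact: leqW.
Qed.

End OneStep.
End ControlledChain.

(** * What a potential secures *)

Section Play.
Context {R : realType} {S : finType} {d : measure_display}.
Context {T : measurableType d}.
Implicit Types (G : @fgame R S) (P : probability T R) (X : nat -> T -> S).

Definition step_kernel G z y (r1 r2 : R) : R :=
  if inner G z then kernel G z y r1 r2 else (y == z)%:R.

(** As both actions are functions of the past states, every expectation in the
    play reduces to a finite sum over cylinders. *)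
Record play G P X (u1 u2 : nat -> T -> R) : Prop := Play {
  play_measurable : forall n s, measurable [set w | X n w = s];
  play_act1 : forall n w, acts1 G (u1 n w);
  play_act2 : forall n w, acts2 G (u2 n w);
  play_past1 : forall n, past X n (u1 n);
  play_past2 : forall n, past X n (u2 n);
  play_law : forall n s, P (cyl X n.+1 s) = (\int[P]_(w in cyl X n s)
    (step_kernel G (s n) (s n.+1) (u1 n w) (u2 n w))%:E)%E
}.

Definition cost_at G X (u1 u2 : nat -> T -> R) n w : R :=
  cost_upto G (X ^~ w) (u1 ^~ w) (u2 ^~ w) n.

Lemma cost_at_dual G X u1 u2 n w :
  cost_at (dual G) X u2 u1 n w = - cost_at G X u1 u2 n w.
Proof.
rewrite /cost_at; elim: n => [|n /= ->] /=; first by case: (inner G _); rewrite ?oppr0.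
rewrite opprD; congr (_ + _); rewrite -[alive (dual G) (X ^~ w) n]/(alive G (X ^~ w) n).
case: (alive G _ _); rewrite ?oppr0// opprD; congr (_ + _).
  by rewrite /flow /= mulrN mulNr.
by case: (inner G _); rewrite ?oppr0.
Qed.

Lemma play_dual G P X u1 u2 : play G P X u1 u2 -> play (dual G) P X u2 u1.
Proof. by case. Qed.

Section Expectation.
Variables (G : @fgame R S) (P : probability T R) (X : nat -> T -> S).
Variables (u1 u2 : nat -> T -> R).
Hypothesis rG : regular G.
Hypothesis pX : play G P X u1 u2.

Let mX := play_measurable pX.
Local Notation alive_at n w := (alive G (X ^~ w) n).
Local Notation time_at n w := (time G (X ^~ w) n).

Lemma step_kernel_sum1 n w :
  \sum_y step_kernel G (X n w) y (u1 n w) (u2 n w) = 1.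
Proof.
rewrite /step_kernel; case: (boolP (inner G (X n w))) => Iz.
  by apply: kernel_sum1 => //; [exact: (play_act1 pX)|exact: (play_act2 pX)].
by rewrite (bigD1 (X n w))//= eqxx big1 ?addr0// => y /negbTE ->.
Qed.

Lemma past_alive n : past X n (fun w => alive_at n w).
Proof. by move=> w w' h; apply: (@alive_agree _ _ _ _ _ n). Qed.

Lemma past_time n k : (k <= n.+1)%N -> past X n (fun w => time_at k w).
Proof. by move=> kn w w' h; apply: (@time_agree _ _ _ _ _ n). Qed.

Lemma past_acts n k w w' : (k <= n)%N ->
  (forall j, (j <= n)%N -> X j w = X j w') -> u1 k w = u1 k w' /\ u2 k w = u2 k w'.
Proof.
by move=> kn h; split; [apply: (play_past1 pX)|apply: (play_past2 pX)] => j jk;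
  apply: h; exact: leq_trans kn.
Qed.

Lemma past_flow n : past X n (fun w => flow G (X ^~ w) (u1 ^~ w) (u2 ^~ w) n).
Proof.
move=> w w' h; apply: (@flow_agree _ _ _ _ _ _ _ _ _ n) => // k kn.
  by have [] := past_acts kn h.
by have [] := past_acts kn h.
Qed.

Lemma past_cost n : past X n (cost_at G X u1 u2 n).
Proof.
move=> w w' h; apply: (@cost_upto_agree _ _ _ _ _ _ _ _ _ n) => // k kn.
  by have [] := past_acts kn h.
by have [] := past_acts kn h.
Qed.

Lemma play_law_step n s : P (cyl X n.+1 s) = (\int[P]_(w in cyl X n s)
  (step_kernel G (X n w) (s n.+1) (u1 n w) (u2 n w))%:E)%E.
Proof.
rewrite (play_law pX); apply: eq_integral => w.
by rewrite inE => /(_ n (leqnn n)) ->.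
Qed.

Lemma past_step_kernel n y :
  past X n (fun w => step_kernel G (X n w) y (u1 n w) (u2 n w)).
Proof.
by move=> w w' h; have [-> ->] := past_acts (leqnn n) h; rewrite h.
Qed.

Variables (F : nat -> R -> S -> R).
Hypothesis Fstop : forall k t z, ~~ inner G z -> F k t z = stop G z.

(** The accumulated cost plus, before exit, the potential of the current state. *)
Definition balance n w : R := cost_at G X u1 u2 n w +
  if alive_at n w then F n (time_at n w) (X n w) else 0.

Definition gain n w : R := if alive_at n w then
  drift_gain G F n (time_at n w) (X n w) (u1 n w) (u2 n w) else 0.

Lemma past_balance n : past X n (balance n).
Proof.
move=> w w' h; rewrite /balance (past_cost h) (past_alive h).
by rewrite (past_time (leqW (leqnn n)) h) h.
Qed.

Lemma past_gain n : past X n (gain n).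
Proof.
move=> w w' h; rewrite /gain (past_alive h) (past_time (leqW (leqnn n)) h) h//.
by have [-> ->] := past_acts (leqnn n) h.
Qed.

(** One step adds the flow of cost and replaces [F n] by [F n.+1], whose conditional
    expectation enters [drift_gain]; on exit [F] equals the terminal payoff, so
    nothing is lost. *)
Lemma expect_balance n :
  \int[P]_w (balance n.+1 w) = \int[P]_w (balance n w) + \int[P]_w (gain n w).
Proof.
pose f w y := cost_at G X u1 u2 n w + if alive_at n w then
  flow G (X ^~ w) (u1 ^~ w) (u2 ^~ w) n + F n.+1 (time_at n.+1 w) y else 0.
have -> : balance n.+1 = fun w => f w (X n.+1 w).
  apply/funext => w; rewrite /balance /f /cost_at /= aliveS.
  case: (alive _ _ _) => /=; last by rewrite !addr0.
  case: ifPn => Iy; first by rewrite addr0 addrA.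
  by rewrite Fstop// addr0 addrA.
rewrite (expect_next mX (@past_step_kernel n) (@play_law_step n)); last first.
  move=> y w w' h; rewrite /f (past_cost h) (past_alive h) (past_flow h).
  by rewrite (past_time (leqnn _) h).
have ib := past_integrable P mX (@past_balance n).
have ig := past_integrable P mX (@past_gain n).
rewrite -RintegralD//; congr Rintegral; apply/funext => w.
under eq_bigr do rewrite /f mulrDl.
rewrite big_split/= -mulr_sumr step_kernel_sum1 mulr1 /balance /gain -addrA.
congr (_ + _); case: ifPn => al; last first.
  by rewrite big1 ?addr0// => y _; rewrite mul0r.
rewrite /drift_gain addrC subrK /stage.
under eq_bigr do rewrite mulrDl.
rewrite big_split/= -mulr_sumr step_kernel_sum1 mulr1 timeS; congr (_ + _).
  by rewrite /flow mulrAC.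
have Iz : inner G (X n w) := alive_inner al.
by apply: eq_bigr => y _; rewrite /step_kernel Iz mulrC.
Qed.

Lemma expect_le n (f g : T -> R) : past X n f -> past X n g ->
  (forall w, f w <= g w) -> \int[P]_w (f w) <= \int[P]_w (g w).
Proof.
move=> pf pg fg; apply: le_Rintegral => //.
- exact: (past_integrable P mX pf).
- exact: (past_integrable P mX pg).
Qed.

Lemma expect_cst (c : R) : \int[P]_(w in setT) c = c.
Proof.
rewrite Rintegral_cst; [|exact: measurableT].
by have := @probability_setT _ _ _ P; rewrite /= => ->; rewrite /= mulr1.
Qed.

Variables (phi : nat -> R -> S -> R) (z : S) (L : R).
Hypothesis Fphi : potential G F phi.
Hypothesis u2phi : forall n w, u2 n w = phi n (time_at n w) (X n w).
Hypothesis X0 : forall w, X 0 w = z.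
Hypothesis costL : \int[P]_w (cost_at G X u1 u2 n w) @[n --> \oo] --> L.

(** The expected balance [m] starts at [F 0 0 z], is nondecreasing and bounded, so
    its increments tend to 0.  From some step on, the expected balance exceeds the
    expected cost by at most [c] times such an increment, by
    [potential_final]. *)
Theorem potential_le_cost : F 0%N 0 z <= L.
Proof.
pose m n := \int[P]_w (balance n w).
have gain0 n w : 0 <= gain n w.
  rewrite /gain; case: ifPn => // al; rewrite u2phi.
  apply: (potential_drift Fphi); [exact: time_ge0|exact: (alive_inner al)|].
  exact: (play_act1 pX).
have m0 : m 0%N = F 0%N 0 z.
  rewrite -[RHS]expect_cst; congr Rintegral; apply/funext => w.
  rewrite /balance /cost_at /= X0 /time big_ord0.
  have -> : alive G (X ^~ w) 0 = inner G z.
    apply/aliveP/idP => [/(_ 0%N (leqnn _))|Iz k]; first by rewrite X0.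
    by rewrite leqn0 => /eqP ->; rewrite X0.
  by case: ifPn => Iz; rewrite ?add0r// addr0 Fstop.
have mS n : m n <= m n.+1.
  by rewrite /m expect_balance lerDl; apply: Rintegral_ge0 => w _; exact: gain0.
have mmon : nondecreasing_seq m by apply/nondecreasing_seqP.
have mbnd : has_ubound (range m).
  have [B BP] := potential_bounded Fphi.
  have [C CP] := tail_bound_exists rG.
  have B0 : 0 <= B by apply: le_trans (BP 0%N 0 z (lexx 0)).
  exists (C + \sum_z `|stop G z| + B) => _ [n _ <-].
  rewrite -[leRHS]expect_cst; apply: (@expect_le n) => // [|w].
    exact: past_balance.
  apply: (le_trans (ler_norm _)); apply: (le_trans (ler_normD _ _)).
  apply: lerD; last first.
    by case: ifP => _; [apply: BP; exact: time_ge0|rewrite normr0].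
  apply: cost_upto_bounded => // k; [exact: (play_act1 pX)|exact: (play_act2 pX)].
have mcvg := nondecreasing_is_cvgn mmon mbnd.
have dm0 : m n.+1 - m n @[n --> \oo] --> (0 : R).
  rewrite -(subrr (limn m)); apply: cvgB => //.
  by rewrite (cvg_shiftS m).
have [N [c [c0 cP]]] := potential_final Fphi.
have ineq n : (N <= n)%N ->
    F 0%N 0 z <= \int[P]_w (cost_at G X u1 u2 n w) + c * (m n.+1 - m n).
  move=> Nn; rewrite -m0; apply: (le_trans (mmon _ _ (leq0n n))).
  have -> : c * (m n.+1 - m n) = \int[P]_w (c * gain n w).
    rewrite RintegralZl//; last exact: (past_integrable P mX (@past_gain n)).
    by rewrite /m expect_balance addrC addKr.
  have ic := past_integrable P mX (@past_cost n).
  have icg : past X n (fun w => c * gain n w).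
    by move=> w w' h; rewrite (past_gain h).
  rewrite -RintegralD//; last exact: (past_integrable P mX icg).
  apply: (@expect_le n); first exact: past_balance.
    by move=> w w' h; rewrite (past_cost h) (past_gain h).
  move=> w; rewrite /balance lerD2l /gain; case: ifPn => al; last by rewrite mulr0.
  rewrite u2phi; apply: cP => //; [exact: time_ge0|exact: (alive_inner al)|].
  exact: (play_act1 pX).
have lim : \int[P]_w (cost_at G X u1 u2 n w) + c * (m n.+1 - m n)
    @[n --> \oo] --> L + c * 0.
  by apply: cvgD => //; apply: cvgMr.
rewrite mulr0 addr0 in lim.
apply: (cvgr_to_ge lim); exists N => // n /= Nn; exact: ineq.
Qed.

End Expectation.
End Play.

(** * The one-step games of the diffusion *)

Section LocalGame.
Context {R : realType} {l m : nat}.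
Implicit Types (D : game R l m).

Lemma segment_closed_convex (U : set R) :
  convex_set (U : set R^o) -> segment_closed U.
Proof.
move=> cU x y t Ux Uy t0 t1.
by have := cU x y (Itv01 t0 t1) (mem_set Ux) (mem_set Uy); rewrite inE.
Qed.

Lemma concave_on_opp (U : set R) (f : R -> R) :
  convex_function (U : set R^o) (f : R^o -> R^o) ->
  concave_on U (fun r => - f r).
Proof.
move=> cf x y t Ux Uy t0 t1.
have := cf (Itv01 t0 t1) x y (mem_set Ux) (mem_set Uy).
by rewrite !convRE /= /unstable.onem; lra.
Qed.

Definition payoff D x i (c A : R) (b : 'I_l -> R) (r1 r2 : R) : R :=
  c * kcost D x i r1 r2 + A + \sum_j b j * drift D x i r1 r2 0 j.

(** Stated for parametrized pairs of actions, to cover the dependence on either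
    action and on both together. *)
Lemma continuous_payoff D x i c A b (V : topologicalType) (B : set V)
    (r1 r2 : V -> R) : A1 D -> dom D x ->
  (forall v, B v -> act1 D (r1 v)) -> (forall v, B v -> act2 D (r2 v)) ->
  continuous r1 -> continuous r2 ->
  {within B, continuous (fun v => payoff D x i c A b (r1 v) (r2 v))}.
Proof.
move=> H1 Gx B1 B2 c1 c2; have [ck cb] := H1 i.
pose e v : 'rV[R]_l * (R * R) := (x, (r1 v, r2 v)).
have ce (f : 'rV[R]_l * (R * R) -> R) :
    {within dom D `*` (act1 D `*` act2 D), continuous f} ->
    {within B, continuous (f \o e)}.
  move=> /subspace_continuousP cf; apply/subspace_continuousP => v Bv.
  have Ev : (dom D `*` (act1 D `*` act2 D)) (e v).
    by split => //; split; [exact: B1|exact: B2].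
  have cev : e u @[u --> v] --> e v.
    exact: (cvg_pair (cvg_cst x) (cvg_pair (c1 v) (c2 v))).
  move=> N /(cf _ Ev) hN; apply: (@filterS _ (nbhs v) _ _ _ _ (cev _ hN)) => u hu Bu.
  by apply: hu; split => //; split; [exact: B1|exact: B2].
move=> v; rewrite /payoff; apply: cvgD.
  apply: cvgD; last exact: cvg_cst.
  by apply: cvgMr; exact: (ce (fun z => kcost D z.1 i z.2.1 z.2.2)).
apply: cvg_big => [|j _]; first exact: add_continuous.
apply: cvgMr; apply: (ce (fun z => drift D z.1 i z.2.1 z.2.2 0 j)).
move=> w; apply: (@continuous_comp _ _ _ _ (fun M : 'rV[R]_l => M 0 j) w).
  exact: cb.
exact: coord_continuous.
Qed.

(** The payoff inherits separability from the drift and the running cost.  In the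
    convex-concave case the drift contributes a bi-affine function, and the
    running cost enters with the nonnegative weight [c]. *)
Lemma payoff_saddle D x i c A b : standing D -> A1 D -> A6 D \/ A7 D ->
  dom D x -> 0 <= c -> saddle_point (act1 D) (act2 D) (payoff D x i c A b).
Proof.
move=> HD H1 H67 Gx c0.
have U0 := act1_nonempty HD; have V0 := act2_nonempty HD.
have cU := act1_compact HD; have cV := act2_compact HD.
have f1 s : act2 D s -> {within act1 D, continuous (payoff D x i c A b ^~ s)}.
  move=> Vs; apply: (@continuous_payoff D x i c A b R (act1 D) id (fun=> s)) => //.
    by move=> ?; exact: cvg_id.
  by move=> ?; exact: cvg_cst.
have f2 r : act1 D r -> {within act2 D, continuous (payoff D x i c A b r)}.
  move=> Ur; apply: (@continuous_payoff D x i c A b R (act2 D) (fun=> r) id) => //.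
    by move=> ?; exact: cvg_cst.
  by move=> ?; exact: cvg_id.
case: H67 => [[b1 [b2 [k1 [k2 sep]]]]|].
  apply: (@saddle_separable R _ _ _
    (fun r1 => c * k1 x i r1 + A + \sum_j b j * b1 x i r1 0 j)
    (fun r2 => c * k2 x i r2 + \sum_j b j * b2 x i r2 0 j)) => // r1 r2 Ur1 Ur2.
  have [bE kE] := sep x i r1 r2 Gx Ur1 Ur2.
  rewrite /payoff kE bE; under eq_bigr do rewrite mxE mulrDr.
  by rewrite big_split/=; ring.
move=> [cvU cvV k1 k2 [b0 [b1 [b2 [b3 [_ bE]]]]]].
have sU := segment_closed_convex cvU; have sV := segment_closed_convex cvV.
have dE r1 r2 : act1 D r1 -> act2 D r2 ->
    \sum_j b j * drift D x i r1 r2 0 j =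
    r1 * r2 * (\sum_j b j * b0 x i 0 j) + r1 * (\sum_j b j * b1 x i 0 j) +
    r2 * (\sum_j b j * b2 x i 0 j) + \sum_j b j * b3 x i 0 j.
  move=> Ur1 Ur2; rewrite !mulr_sumr -!big_split /=; apply: eq_bigr => j _.
  by rewrite bE// !mxE; ring.
apply: saddle_convex_concave => //.
  move=> s Vs r r' t Ur Ur' t0 t1.
  have Ut := sU r r' t Ur Ur' t0 t1.
  have := concave_on_opp (k1 x i s Gx Vs) Ur Ur' t0 t1.
  move=> /(ler_wpM2l c0); rewrite /payoff !dE//.
  set s0 := \sum_j _; set s1 := \sum_j _; set s2 := \sum_j _; set s3 := \sum_j _.
  move=> h; rewrite -subr_ge0; rewrite -subr_ge0 in h; apply: (le_trans h).
  by rewrite le_eqVlt; apply/orP; left; apply/eqP; ring.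
move=> r Ur s s' t Vs Vs' t0 t1.
have Vt := sV s s' t Vs Vs' t0 t1.
have := concave_on_opp (k2 x i r Gx Ur) Vs Vs' t0 t1.
move=> /(ler_wpM2l c0); rewrite /payoff !dE//.
set s0 := \sum_j _; set s1 := \sum_j _; set s2 := \sum_j _; set s3 := \sum_j _.
move=> h; rewrite -subr_ge0; rewrite -subr_ge0 in h; apply: (le_trans h).
by rewrite le_eqVlt; apply/orP; left; apply/eqP; ring.
Qed.

Lemma kcost_bounded D x i : standing D -> A1 D -> dom D x ->
  exists2 M, 0 <= M & forall r1 r2, act1 D r1 -> act2 D r2 ->
    `|kcost D x i r1 r2| <= M.
Proof.
move=> HD H1 Gx.
have cB := compact_setX (act1_compact HD) (act2_compact HD).
have ck : {within act1 D `*` act2 D, continuous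
    (fun v => payoff D x i 1 0 (fun=> 0) v.1 v.2)}.
  apply: (@continuous_payoff D x i 1 0 (fun=> 0) (R * R)%type) => //.
  - by move=> v [].
  - by move=> v [].
  - by move=> v; exact: cvg_fst.
  - by move=> v; exact: cvg_snd.
have [M [_ MP]] := compact_bounded (continuous_compact ck cB).
exists (Num.max M 0 + 1); first by rewrite addr_ge0// le_max lexx orbT.
move=> r1 r2 Ur1 Ur2.
have -> : kcost D x i r1 r2 = payoff D x i 1 0 (fun=> 0) r1 r2.
  by rewrite /payoff big1 ?addr0 ?mul1r// => j _; rewrite mul0r.
apply: MP; last by exists (r1, r2).
by rewrite ltr_pwDr// le_max lexx.
Qed.

(** The actions enter the transition probabilities only through the drift, which
    appears linearly in the probabilities of the moves along the axes. *)
Lemma trans_affine D h z z' : exists (A : R) (b : 'I_l -> R), forall r1 r2,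
  trans D h z z' r1 r2 = A + \sum_j b j * drift D z.1 z.2 r1 r2 0 j.
Proof.
case: z z' => [x i] [y i']; rewrite /trans /=.
set d := normalizer D h x i - _; set a := diffusion D x i.
pose e (j : 'I_l) : 'rV[R]_l := h *: unitv j.
pose tail1 := \sum_(j < l) \sum_(k < l | (j < k)%N)
  ((y == x + e j + e k)%:R + (y == x - e j - e k)%:R) *
  (2^-1 * Num.max (a j k) 0 / d).
pose tail2 := \sum_(j < l) \sum_(k < l | j != k)
  (y == x + e j - e k)%:R * (2^-1 * Num.max (- a j k) 0 / d).
pose jump := ((y == x) && (i' != i))%:R * (gen D i i' * h ^+ 2 / d).
pose up j : R := (y == x + h *: unitv j)%:R.
pose dn j : R := (y == x - h *: unitv j)%:R.
exists ((i' == i)%:R * (\sum_j (up j + dn j) * (dominance a j / (2 * d)) + tail1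
   + tail2) + jump), (fun j => (i' == i)%:R * ((up j - dn j) * (h / (2 * d)))).
move=> r1 r2; rewrite -/tail1 -/tail2 -/jump; clearbody tail1 tail2 jump.
under [in RHS]eq_bigr do rewrite -mulrA.
rewrite -[in RHS]mulr_sumr [RHS]addrAC -mulrDr; congr (_ * _ + _).
rewrite [RHS]addrC !addrA -big_split /=; congr (_ + _ + _).
by apply: eq_bigr => j _; rewrite -/(up j) -/(dn j); ring.
Qed.

(** Diagonal dominance bounds the sum of the off-diagonal entries by the trace, the
    diagonal of a generator is nonpositive, and the discount makes the bound
    strict. *)
Lemma normalizer_gt0 D h x i : standing D -> A4 D -> dom D x -> 0 < h ->
  0 < normalizer D h x i.
Proof.
move=> HD H4 Gx h0.
have hh : 0 < h ^+ 2 by rewrite exprn_gt0.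
have [Q0 Q1] := gen_generator HD.
have qii : gen D i i <= 0.
  have := Q1 i; rewrite (bigD1 i)//= => /eqP; rewrite addr_eq0 => /eqP ->.
  by rewrite oppr_le0 sumr_ge0// => j; rewrite eq_sym; exact: Q0.
rewrite /normalizer; set a := diffusion D x i.
have le_a : \sum_(j < l) \sum_(k < l | (j < k)%N) `|a j k| <= \sum_j a j j.
  apply: ler_sum => j _; apply: le_trans (ltW (H4 x i j Gx)).
  rewrite [leRHS](bigID (fun k : 'I_l => (j < k)%N))/=.
  rewrite [X in _ <= X + _](eq_bigl (fun k : 'I_l => (j < k)%N)); last first.
    move=> k; case: ltngtP => // jk; rewrite ?andbF ?andbT//.
    by apply/eqP => kj; rewrite kj ltnn in jk.
  by rewrite lerDl sumr_ge0.
have bh : 0 < beta D * h ^+ 2 by rewrite mulr_gt0// beta_gt0.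
have qh : 0 <= - (gen D i i * h ^+ 2) by rewrite oppr_ge0 mulr_le0_ge0// ltW.
by lra.
Qed.

Lemma time_step_gt0 D h x i : standing D -> A4 D -> dom D x -> 0 < h ->
  0 < time_step D h x i.
Proof.
by move=> *; rewrite /time_step divr_gt0 ?exprn_gt0// normalizer_gt0.
Qed.

End LocalGame.

(** * The game on the grid *)

Section CostLimit.
Context {R : realType} {S : finType} {d : measure_display}.
Context {T : measurableType d}.

(** Dominated convergence: the partial costs are uniformly bounded. *)
Lemma expected_cost_limit (G : @fgame R S) (P : probability T R)
    (X : nat -> T -> S) (u1 u2 : nat -> T -> R) (c : T -> R) :
  regular G -> play G P X u1 u2 ->
  (forall w, cost_at G X u1 u2 n w @[n --> \oo] --> c w) ->
  exists2 L, 'E_P[c]%E = L%:E &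
    \int[P]_w (cost_at G X u1 u2 n w) @[n --> \oo] --> L.
Proof.
move=> rG pX cl; have mX := play_measurable pX.
have [C CP] := tail_bound_exists rG.
pose B := C + \sum_z `|stop G z|.
have icost n := past_integrable P mX (@past_cost _ _ _ _ _ _ _ _ _ pX n).
have mcost n : measurable_fun setT (cost_at G X u1 u2 n).
  by apply/measurable_EFinP; case/integrableP: (icost n).
have mc : measurable_fun setT c.
  by apply: (measurable_fun_cvg mcost) => w _; exact: cl.
have costB n w : `|cost_at G X u1 u2 n w| <= B.
  apply: cost_upto_bounded => // k; [exact: (play_act1 pX)|exact: (play_act2 pX)].
have [] := @dominated_convergence _ _ _ P setT measurableT
  (fun n => EFin \o cost_at G X u1 u2 n) (EFin \o c) (EFin \o cst B).
- by move=> n; apply/measurable_EFinP.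
- exact/measurable_EFinP.
- by apply: aeW => w _; apply: cvg_EFin; [exact: nearW|exact: cl].
- exact: finite_measure_integrable_cst.
- by apply: aeW => w n _; rewrite /= lee_fin.
move=> ic _ lim; exists (fine (\int[P]_w (c w)%:E)%E).
  by rewrite unlock fineK//; exact: (integrable_fin_num measurableT ic).
apply: fine_cvg; rewrite fineK; first exact: lim.
exact: (integrable_fin_num measurableT ic).
Qed.

End CostLimit.

Section GridGame.
Context {R : realType} {l m : nat}.
Variables (D : game R l m) (h : R) (gs : seq ('rV[R]_l * 'I_m)).
Hypothesis gsP : forall z, (z \in gs) = `[< grid D h z.1 >].

Let S : finType := seq_sub gs.

Definition grid_game : @fgame R S := FGame
  (fun z : S => `[< grid_int D h (val z).1 >])
  (fun z y r1 r2 => trans D h (val z) (val y) r1 r2)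
  (fun z r1 r2 => kcost D (val z).1 (val z).2 r1 r2)
  (fun z => gcost D (val z).1 (val z).2)
  (fun z => time_step D h (val z).1 (val z).2)
  (beta D) (act1 D) (act2 D).

(** On exit the partial costs are eventually constant; on a path that never leaves
    they are the partial sums of an absolutely convergent series. *)
Lemma grid_game_cost (xi : nat -> S) (v1 v2 : nat -> R) (C : R) :
  regular grid_game -> tail_bound grid_game C ->
  (forall n, act1 D (v1 n)) -> (forall n, act2 D (v2 n)) ->
  cost_upto grid_game xi v1 v2 n @[n --> \oo] -->
  path_cost D h (fun n => val (xi n)) v1 v2.
Proof.
move=> rG CP v1P v2P; rewrite /path_cost /exit_step.
case: pselect => [ex|nex].
  case: ex_minnP => N /asboolP exN minN.
  have inN k : (k < N)%N -> inner grid_game (xi k).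
    move=> kN; apply/asboolP; apply: contrapT => nk.
    by have := minN k; rewrite leqNgt kN => /(_ (asboolT nk)).
  apply: cvg_near_cst; exists N => // n /= Nn.
  rewrite (cost_upto_exit v1 v2 inN) //.
  by apply/negP => /asboolP.
have inX k : inner grid_game (xi k).
  by apply/asboolP; apply: contrapT => nk; apply: nex; exists k; apply/asboolP.
have -> : (fun n => cost_upto grid_game xi v1 v2 n) = series (flow grid_game xi v1 v2).
  apply/funext => n; rewrite cost_upto_inner//.
  by rewrite /series /= big_mkord.
exact: (flow_summable rG CP v1P v2P inX).
Qed.

Section Actions.
Context {T : Type}.
Variables (X : nat -> T -> state R l m) (ua ub : nat -> T -> R).
Variables (ca cb : control R l m) (U : set R).
Hypothesis first_ca : goes_first U ca.
Hypothesis uaE : forall n w, ua n w = @ca n [tuple X k w | k < n.+1]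
  [tuple ua k w | k < n] [tuple ub k w | k < n.+1].
Hypothesis ubE : forall n w, ub n w = @cb n [tuple X k w | k < n.+1]
  [tuple ub k w | k < n] [tuple ua k w | k < n.+1].

(** Induction on the step: the player who goes first sees the states and the earlier
    actions, which are determined by the states, and then so is the answer of the
    player who goes last. *)
Lemma actions_past n w w' : (forall k, (k <= n)%N -> X k w = X k w') ->
  ua n w = ua n w' /\ ub n w = ub n w'.
Proof.
elim/ltn_ind: n => n IH XE.
have {}IH k : (k < n)%N -> ua k w = ua k w' /\ ub k w = ub k w'.
  by move=> kn; apply: IH => // j jk; apply: XE; apply: leq_trans jk (ltnW kn).
have stE : [tuple X k w | k < n.+1] = [tuple X k w' | k < n.+1].
  by apply: eq_mktuple => k; rewrite XE// -ltnS.
have uaE' : ua n w = ua n w'.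
  rewrite !uaE stE.
  have -> : [tuple ua k w | k < n] = [tuple ua k w' | k < n].
    by apply: eq_mktuple => k; have [] := IH k (ltn_ord k).
  apply: first_ca.2; apply: (@eq_from_nth _ 0).
    by rewrite !size_take !size_tuple.
  move=> k; rewrite size_take size_tuple ltnS leqnn => kn; rewrite !nth_take//.
  have kn1 : (k < n.+1)%N by exact: ltnW.
  rewrite -[k]/(nat_of_ord (Ordinal kn1)) -!tnth_nth !tnth_mktuple /=.
  by have [] := IH k kn.
split=> //; rewrite !ubE stE; congr (@cb n _ _ _).
  by apply: eq_mktuple => k; have [] := IH k (ltn_ord k).
apply: eq_mktuple => k; have := ltn_ord k; rewrite ltnS leq_eqVlt.
by move=> /predU1P[->//|/IH[]].
Qed.

End Actions.

Section Chain.
Variables (z : S) (c1 c2 : control R l m) (Y : process R l m).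
Hypothesis chY : controlled_chain D h (val z) c1 c2 Y.
Hypothesis c12 : (goes_first (act1 D) c1 /\ goes_last (act2 D) c2) \/
  (goes_last (act1 D) c1 /\ goes_first (act2 D) c2).

Lemma chain_mem n w : pX Y n w \in gs.
Proof. by rewrite gsP; apply/asboolP; exact: (chain_grid chY). Qed.

Definition chain_state n w : S := SeqSub (chain_mem n w).

Lemma chain_play : play grid_game (pP Y) chain_state (pu1 Y) (pu2 Y).
Proof.
have XE n w s : (chain_state n w = s) = (pX Y n w = val s).
  by apply/propext; split=> [<-//|e]; apply: val_inj.
have pastE n w w' : (forall k, (k <= n)%N -> chain_state k w = chain_state k w') ->
    pu1 Y n w = pu1 Y n w' /\ pu2 Y n w = pu2 Y n w'.
  move=> e; have {}e k : (k <= n)%N -> pX Y k w = pX Y k w'.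
    by move=> /e; rewrite XE.
  case: c12 => [[fst1 _]|[_ fst2]].
    exact: (actions_past fst1 (chain_u1 chY) (chain_u2 chY) e).
  by have [-> ->] := actions_past fst2 (chain_u2 chY) (chain_u1 chY) e.
have last1 : goes_last (act1 D) c1 by case: c12 => -[] // [].
have last2 : goes_last (act2 D) c2 by case: c12 => -[] // ? [].
split.
- move=> n s; rewrite (_ : [set _ | _] = [set w | pX Y n w = val s]).
    exact: (chain_measurable chY).
  by apply/seteqP; split=> w /=; rewrite XE.
- by move=> n w; rewrite (chain_u1 chY); exact: last1.1.
- by move=> n w; rewrite (chain_u2 chY); exact: last2.1.
- by move=> n w w' e; have [] := pastE n w w' e.
- by move=> n w w' e; have [] := pastE n w w' e.
- move=> n s; have cylE k : cyl chain_state k s = cylinder Y k (fun j => val (s j)).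
    by apply/seteqP; split=> w e j jk; have := e j jk; rewrite XE.
  rewrite !cylE (chain_trans chY); apply: eq_integral => w _; congr EFin.
  rewrite /stopped_trans /step_kernel /=; case: ifP => // _.
  by congr (_ %:R); congr nat_of_bool; apply/asboolP/eqP => [/val_inj|->].
Qed.

Lemma chain_expected_cost : regular grid_game ->
  exists2 L, expected_cost D h Y = L%:E &
  \int[pP Y]_w (cost_at grid_game chain_state (pu1 Y) (pu2 Y) n w)
    @[n --> \oo] --> L.
Proof.
move=> rG; have [C CP] := tail_bound_exists rG.
apply: expected_cost_limit => //; first exact: chain_play.
move=> w; apply: (@grid_game_cost (fun n => chain_state n w)
  (pu1 Y ^~ w) (pu2 Y ^~ w) C rG CP).
  by move=> n; exact: (play_act1 chain_play).
by move=> n; exact: (play_act2 chain_play).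
Qed.

Lemma chain_state0 w : chain_state 0 w = z.
Proof. by apply: val_inj; exact: (chain_init chY). Qed.

End Chain.

(** The control that forgets all actions and reads off the history only the number
    of steps, the elapsed time and the current state; [z0] is a default for
    states off the grid. *)
Definition strategy (z0 : S) (phi : nat -> R -> S -> R) : control R l m :=
  fun n s _ _ => phi n
    (\sum_(k < n) time_step D h (tnth s (widen_ord (leqnSn n) k)).1
                               (tnth s (widen_ord (leqnSn n) k)).2)
    (insubd z0 (tnth s ord_max)).

Definition constant_control (r : R) : control R l m := fun _ _ _ _ => r.

Lemma goes_first_constant U r : U r -> goes_first U (constant_control r).
Proof.
by move=> Ur; split=> //; split=> // n s; exact: measurable_cst.
Qed.

Lemma goes_first_strategy U z0 phi : (forall k t z, U (phi k t z)) ->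
  goes_first U (strategy z0 phi).
Proof.
by move=> Uphi; split=> //; split=> [*|n s]; [exact: Uphi|exact: measurable_cst].
Qed.

Lemma strategy_chain z0 phi n (X : nat -> S) own opp :
  strategy z0 phi [tuple val (X k) | k < n.+1] own opp =
  phi n (time grid_game X n) (X n).
Proof.
rewrite /strategy tnth_mktuple /= valKd; congr (phi n _ _).
by apply: eq_bigr => k _; rewrite tnth_mktuple.
Qed.

Variable Y : state R l m -> control R l m -> control R l m -> process R l m.
Hypothesis HY : chain_family D h Y.

Lemma grid_val (z : S) : grid D h (val z).1.
Proof. by apply/asboolP; rewrite -gsP; exact: valP. Qed.

(** The chain controlled by two constant actions moves to [y] in its first step with
    probability [kernel z y r1 r2]; hence these numbers are nonnegative with
    sum 1. *)
Lemma kernel_expectation (z : S) r1 r2 (Y0 := Y (val z) (constant_control r1)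
    (constant_control r2)) : inner grid_game z -> act1 D r1 -> act2 D r2 ->
  exists2 X : nat -> pT Y0 -> S, (forall n s, measurable [set w | X n w = s]) &
    forall y, kernel grid_game z y r1 r2 = \int[pP Y0]_w (X 1 w == y)%:R.
Proof.
move=> Iz Ur1 Ur2.
have c12 : (goes_first (act1 D) (constant_control r1) /\
     goes_last (act2 D) (constant_control r2)) \/
    (goes_last (act1 D) (constant_control r1) /\
     goes_first (act2 D) (constant_control r2)).
  left; split; first exact: goes_first_constant.
  by have [] := goes_first_constant Ur2.
have chY : controlled_chain D h (val z) (constant_control r1)
  (constant_control r2) Y0 by apply: HY => //; exact: grid_val.
have pY := chain_play chY c12; exists (chain_state chY).
  exact: (play_measurable pY).
move=> y.
transitivity (\int[pP Y0]_w (1 * (chain_state chY 1 w == y)%:R)); last first.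
  by congr Rintegral; apply/funext => w; rewrite mul1r.
rewrite (expect_next_state (play_measurable pY) (@past_step_kernel _ _ _ _ _ _ _ _ _ pY 0)
  (@play_law_step _ _ _ _ _ _ _ _ _ pY 0))//.
rewrite -[LHS](@expect_cst _ _ _ (pP Y0)); congr Rintegral; apply/funext => w.
rewrite mul1r chain_state0 /step_kernel Iz.
by rewrite (chain_u1 chY) (chain_u2 chY).
Qed.

Lemma grid_game_regular : standing D -> A1 D -> A4 D -> A6 D \/ A7 D ->
  0 < h -> regular grid_game.
Proof.
move=> HD H1 H4 H67 h0.
have Gz (z : S) : dom D (val z).1 by apply: (grid_sub HD h0); exact: grid_val.
split.
- exact: act1_nonempty.
- exact: act2_nonempty.
- move=> z y r1 r2 Iz Ur1 Ur2; have [X _ ->] := kernel_expectation Iz Ur1 Ur2.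
  by apply: Rintegral_ge0.
- move=> z r1 r2 Iz Ur1 Ur2; have [X mX kE] := kernel_expectation Iz Ur1 Ur2.
  under eq_bigr do rewrite kE.
  rewrite -Rintegral_sum => [|y]; last first.
    by apply: (past_integrable _ mX (n := 1)) => w w' ->.
  rewrite -[RHS](@expect_cst _ _ _ (pP (Y (val z) (constant_control r1)
    (constant_control r2)))).
  congr Rintegral; apply/funext => w.
  by rewrite (bigD1 (X 1 w))//= eqxx big1 ?addr0// => y; rewrite eq_sym => /negbTE ->.
- have /choice[M MP] : forall z : S, exists M, 0 <= M /\ forall r1 r2,
      act1 D r1 -> act2 D r2 -> `|kcost D (val z).1 (val z).2 r1 r2| <= M.
    by move=> z; have [M M0 MP] := kcost_bounded (val z).2 HD H1 (Gz z); exists M.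
  exists (\sum_z M z); first by apply: sumr_ge0 => z _; exact: (MP z).1.
  move=> z r1 r2 _ Ur1 Ur2; apply: le_trans ((MP z).2 r1 r2 Ur1 Ur2) _.
  by rewrite (bigD1 z)//= lerDl; apply: sumr_ge0 => y _; exact: (MP y).1.
- by move=> z; exact: time_step_gt0.
- exact: beta_gt0.
- move=> z c W Iz c0.
  have /choice[A /choice[b bE]] : forall y : S, exists A (b : 'I_l -> R),
      forall r1 r2, trans D h (val z) (val y) r1 r2 =
        A + \sum_j b j * drift D (val z).1 (val z).2 r1 r2 0 j.
    by move=> y; exact: trans_affine.
  have -> : stage grid_game z c W = payoff D (val z).1 (val z).2 c
      (\sum_y A y * W y) (fun j => \sum_y b y j * W y).
    apply/funext => r1; apply/funext => r2; rewrite /stage /payoff /= -addrA.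
    congr (_ + _); under eq_bigr do rewrite bE mulrDl mulr_suml.
    rewrite big_split/= exchange_big/=; congr (_ + _).
    apply: eq_bigr => j _; rewrite mulr_suml; apply: eq_bigr => y _.
    by rewrite mulrAC.
  exact: payoff_saddle.
Qed.

Hypothesis rG : regular grid_game.

(** The maximizer moves first with the strategy of the potential; the bound holds
    against every answer. *)
Lemma potential_le_lower_value F phi (z : S) : potential grid_game F phi ->
  ((F 0%N 0 z)%:E <= lower_value D h Y (val z))%E.
Proof.
move=> pF; have fst2 : goes_first (act2 D) (strategy z phi).
  by apply: goes_first_strategy; exact: (potential_act pF).
apply: le_trans (ereal_sup_ubound _); last by exists (strategy z phi).
apply: le_ereal_inf_tmp => _ [c1 last1 <-].
have c12 : (goes_first (act1 D) c1 /\ goes_last (act2 D) (strategy z phi)) \/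
    (goes_last (act1 D) c1 /\ goes_first (act2 D) (strategy z phi)) by right.
have chY := HY (grid_val z) c12; have pY := chain_play chY c12.
have [L -> limL] := chain_expected_cost chY c12 rG.
rewrite lee_fin; apply: (potential_le_cost rG pY (potential_stop pF) pF _ _ limL).
  move=> n w; rewrite (chain_u2 chY).
  exact: (strategy_chain _ _ (chain_state chY ^~ w)).
by move=> w; exact: chain_state0.
Qed.

(** The minimizer moves first with the strategy of a potential of the dual game. *)
Lemma upper_value_le_potential F phi (z : S) : potential (dual grid_game) F phi ->
  (upper_value D h Y (val z) <= (- F 0%N 0 z)%:E)%E.
Proof.
move=> pF; have fst1 : goes_first (act1 D) (strategy z phi).
  by apply: goes_first_strategy; exact: (potential_act pF).
apply: (le_trans (ereal_inf_lbound _)); first by exists (strategy z phi).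
apply: ge_ereal_sup => _ [c2 last2 <-].
have c12 : (goes_first (act1 D) (strategy z phi) /\ goes_last (act2 D) c2) \/
    (goes_last (act1 D) (strategy z phi) /\ goes_first (act2 D) c2) by left.
have chY := HY (grid_val z) c12; have pY := chain_play chY c12.
have [L -> limL] := chain_expected_cost chY c12 rG.
rewrite lee_fin lerNr.
apply: (potential_le_cost (regular_dual rG) (play_dual pY) (potential_stop pF) pF).
- move=> n w; rewrite (chain_u1 chY).
  exact: (strategy_chain _ _ (chain_state chY ^~ w)).
- by move=> w; exact: chain_state0.
- have mX := play_measurable pY.
  under eq_fun => n.
    rewrite (_ : Rintegral _ _ _ = - \int[pP (Y (val z) (strategy z phi) c2)]_w
      cost_at grid_game (chain_state chY) (pu1 _) (pu2 _) n w); last first.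
      rewrite -mulN1r -RintegralZl//.
        by congr Rintegral; apply/funext => w; rewrite cost_at_dual mulN1r.
      by apply: (past_integrable _ mX); exact: (past_cost pY).
    over.
  exact: cvgN.
Qed.

Lemma lower_le_upper (z : S) :
  (lower_value D h Y (val z) <= upper_value D h Y (val z))%E.
Proof.
apply: ge_ereal_sup => _ [c2 fst2 <-]; apply: le_ereal_inf_tmp => _ [c1 fst1 <-].
apply: (@le_trans _ _ (expected_cost D h (Y (val z) c1 c2))).
  by apply: ereal_inf_lbound; exists c1 => //; exact: fst1.1.
by apply: ereal_sup_ubound; exists c2 => //; exact: fst2.1.
Qed.

Lemma grid_game_value (z : S) :
  upper_value D h Y (val z) = lower_value D h Y (val z).
Proof.
apply/le_anti; rewrite lower_le_upper andbT.
apply/lee_addgt0Pr => e e0.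
have [F [phi [F' [phi' [pF pF' FF']]]]] := potentials_meet rG e0.
apply: (le_trans (upper_value_le_potential z pF')).
apply: (@le_trans _ _ (F 0%N 0 z + e)%:E); first by rewrite lee_fin FF'.
by rewrite EFinD leeD2r//; exact: (potential_le_lower_value z pF).
Qed.

End GridGame.

Theorem mainTheorem3 (R : realType) (l m : nat) (l_gt0 : (0 < l)%N)
  (D : game R l m) (HD : standing D)
  (H1 : A1 D) (H2 : A2 D) (H3 : A3 D) (H4 : A4 D) (H5 : A5 D)
  (H67 : A6 D \/ A7 D)
  (h : R) (h_gt0 : 0 < h)
  (Hh : forall (x : 'rV[R]_l) (i : 'I_m) (j0 : 'I_l), grid D h x ->
     forall r1 r2, act1 D r1 -> act2 D r2 ->
     forall j : 'I_l,
       h * `|drift D x i r1 r2 0 j0| <= dominance (diffusion D x i) j)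
  (Y : state R l m -> control R l m -> control R l m -> process R l m)
   (HY : chain_family D h Y) :
  forall (x : 'rV[R]_l) (i : 'I_m), grid D h x ->
    upper_value D h Y (x, i) = lower_value D h Y (x, i).
Proof.
move=> x i gx.
have /finite_seqP[xs xsE] := grid_finite HD h_gt0.
pose gs := [seq (y, j) | y <- xs, j <- enum 'I_m].
have gsP z : (z \in gs) = `[< grid D h z.1 >].
  rewrite xsE /=; case: z => y j.
  apply/allpairsP/asboolP => [[[y' j'] /= [h1 _ [-> _]]]|yxs].
    exact: h1.
  by exists (y, j); split; rewrite ?mem_enum.
have xi : (x, i) \in gs by rewrite gsP; exact/asboolP.
have rG := grid_game_regular gsP HY HD H1 H4 H67 h_gt0.
exact: (grid_game_value gsP HY rG (SeqSub xi)).
Qed.
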